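(* Let $s \in \mathbb{N}$, let $b$ be a prime, let $m \in \mathbb{N}$, $N = b^m$, and let $0 = w_1 \leq w_2 \leq \cdots$ be a sequence of non-negative integers. Let $\alpha > 1$ be real and let $(\gamma_j)_{j \ge 1}$ be positive weights with $\gamma_{\mathfrak{u}} = \prod_{j \in \mathfrak{u}} \gamma_j$. Let $\tilde{\boldsymbol{z}} = (\tilde{z}_1, \dots, \tilde{z}_s)$ be constructed by the combined component-by-component algorithm described in the context, with exclusion sets $\mathcal{E}_1, \dots, \mathcal{E}_s$, and define the auxiliary exclusion sets $\tilde{\mathcal{E}}_j := (\mathcal{Z}_N \setminus \mathcal{Z}_{N,w_j}) \cup \mathcal{E}_j$ for $j \in \{1, \dots, s\}$. Then for all $1 \leq d \leq s$ we have $$e^2(\tilde{z}_1, \dots, \tilde{z}_d) \leq \left( \frac{1}{\phi(N)} \sum_{\mathfrak{u} \subseteq \{1,\dots,d\}} \gamma_{\mathfrak{u}}^{\lambda} (2 \zeta(\alpha \lambda))^{|\mathfrak{u}|} \prod_{j \in \mathfrak{u}} \frac{\phi(N)}{\phi(N) - |\tilde{\mathcal{E}}_j|} \right)^{\frac{1}{\lambda}}$$ for any $\frac{1}{\alpha} < \lambda \leq 1$, where a product over the empty set is $1$.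
   Context: Notation: $\mathbb{N} = \{1,2,\dots\}$; $\phi$ is the Euler totient function; $\zeta$ is the Riemann zeta function; $|\cdot|$ of a finite set is its cardinality; $\gamma_\emptyset = 1$. Search spaces: $\mathcal{Z}_N = \{ z \in \{1, \dots, N-1\} : \gcd(z,N) = 1\}$. For $j \in \mathbb{N}$, $\mathcal{Z}_{N,w_j} = \{ z \in \{1, \dots, b^{m-w_j}-1\} : \gcd(z,b^m) = 1\}$ if $w_j < m$, and $\mathcal{Z}_{N,w_j} = \{1\}$ if $w_j \geq m$. (So $\mathcal{Z}_{N,w_j} = \mathcal{Z}_N$ when $w_j = 0$.) Weighted Korobov space and worst-case error: For $\boldsymbol{h} = (h_1, \dots, h_d) \in \mathbb{Z}^d$ set $r_\alpha(\boldsymbol{\gamma}, \boldsymbol{h}) = \prod_{j=1}^d r_\alpha(\gamma_j, h_j)$, where $r_\alpha(\gamma_j, 0) = 1$ and $r_\alpha(\gamma_j, h_j) = \gamma_j / |h_j|^\alpha$ for $h_j \neq 0$. The weighted Korobov space $H(K_{d,\alpha,\boldsymbol{\gamma}})$ is the reproducing kernel Hilbert space of functions on $[0,1]^d$ with kernel $K_{d,\alpha,\boldsymbol{\gamma}}(\boldsymbol{x}, \boldsymbol{y}) = \sum_{\boldsymbol{h} \in \mathbb{Z}^d} r_\alpha(\boldsymbol{\gamma}, \boldsymbol{h}) \exp(2\pi \mathrm{i}\, \boldsymbol{h} \cdot (\boldsymbol{x} - \boldsymbol{y}))$. For $\boldsymbol{z} = (z_1,\dots,z_d) \in \{0, \dots,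 N-1\}^d$, $e(\boldsymbol{z}) = e(z_1,\dots,z_d)$ denotes the worst-case error of integration in $H(K_{d,\alpha,\boldsymbol{\gamma}})$, i.e. the supremum over $f$ in its unit ball of $\left| \int_{[0,1]^d} f(\boldsymbol{x})\, d\boldsymbol{x} - \frac{1}{N} \sum_{k=0}^{N-1} f(\{k\boldsymbol{z}/N\}) \right|$, where $\{\cdot\}$ is the componentwise fractional part. It is known that its square is $$e^2(\boldsymbol{z}) = \sum_{\substack{\boldsymbol{h} \in \mathbb{Z}^d \setminus \{\boldsymbol{0}\} \\ \boldsymbol{z} \cdot \boldsymbol{h} \equiv 0 \pmod N}} r_\alpha(\boldsymbol{\gamma}, \boldsymbol{h}).$$ Combined component-by-component algorithm (produces $\tilde{\boldsymbol{z}} = (\tilde z_1, \dots, \tilde z_s)$): 1. Set $z_1 = 1$, $\tilde z_1 = z_1 = 1$ and $\mathcal{E}_1 = \emptyset$. 2. Successively for $d = 1, \dots, s-1$, assuming $\tilde z_1, \dots, \tilde z_d$ have been found: - If $w_{d+1} < m$: choose an arbitrary proper subset $\mathcal{E}_{d+1} \subsetneq \mathcal{Z}_{N,w_{d+1}}$ (possibly empty; it may depend on the components already chosen). Choose $z_{d+1} \in \mathcal{Z}_{N,w_{d+1}} \setminus \mathcal{E}_{d+1}$ such that $e^2(\tilde z_1, \dots, \tilde z_d, b^{w_{d+1}} z_{d+1})$ is minimized as a function of $z_{d+1}$ over $\mathcal{Z}_{N,w_{d+1}} \setminus \mathcal{E}_{d+1}$, and set $\tilde z_{d+1} = b^{w_{d+1}}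 z_{d+1}$. - If $w_{d+1} \geq m$: set $\mathcal{E}_{d+1} = \emptyset$ and $\tilde z_{d+1} = z_{d+1} = 0$. *)

(* Defs.v *)
From HB Require Import structures.
From mathcomp Require Import all_boot all_order all_algebra.
From mathcomp Require Import complex.
From mathcomp Require Import all_classical all_reals all_analysis.

Set Implicit Arguments.
Unset Strict Implicit.
Unset Printing Implicit Defensive.

Import Order.TTheory GRing.Theory Num.Theory.
Import numFieldNormedType.Exports.

Local Open Scope classical_set_scope.
Local Open Scope complex_scope.
Local Open Scope ring_scope.

(* Sequences written 1, 2, 3, ... in the mathematics (w, gamma, z, E) are
   functions on nat whose value at 0 is never used. *)

(* The series converges for s > 1 only. *)
Definition zeta (R : realType) (s : R) : R :=
  limn (series (fun n : nat => (n.+1%:R : R) `^ (- s))).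

(* Functions on D are represented by total functions whose values outside D
   are irrelevant: a function is null in H iff it vanishes on D.  By the
   Moore-Aronszajn theorem there is, up to values outside D, exactly one
   such space for each positive definite kernel; it is a space of complex
   functions, with an inner product linear in its first argument. *)
Record rkhs (R : realType) (T : Type) (D : set T) (K : T -> T -> R[i]) :=
  RKHS {
  rk_space : set (T -> R[i]) ;
  rk_ip : (T -> R[i]) -> (T -> R[i]) -> R[i] ;
  rk_zero : rk_space (fun _ => 0) ;
  rk_lin : forall (a : R[i]) f g, rk_space f -> rk_space g ->
    rk_space (fun x => a * f x + g x) ;
  rk_ip_linear : forall (a : R[i]) f g h,
    rk_space f -> rk_space g -> rk_space h ->
    rk_ip (fun x => a * f x + g x) h = a * rk_ip f h + rk_ip g h ;
  rk_ip_conj : forall f g, rk_space f -> rk_space g ->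
    rk_ip g f = (rk_ip f g)^* ;
  rk_ip_ge0 : forall f, rk_space f -> 0 <= rk_ip f f ;
  rk_ip_eq0 : forall f, rk_space f ->
    rk_ip f f = 0 <-> (forall x, D x -> f x = 0) ;
  rk_complete : forall u : nat -> (T -> R[i]), (forall n, rk_space (u n)) ->
    (forall eps : R, 0 < eps -> exists n0 : nat, forall n p : nat,
      (n0 <= n)%N -> (n0 <= p)%N ->
      rk_ip (fun x => u n x - u p x) (fun x => u n x - u p x) < eps%:C) ->
    exists2 f, rk_space f &
    (forall eps : R, 0 < eps -> exists n0 : nat, forall n : nat, (n0 <= n)%N ->
      rk_ip (fun x => u n x - f x) (fun x => u n x - f x) < eps%:C) ;
  rk_kernel : forall y, D y -> rk_space (fun x => K x y) ;
  rk_reproducing : forall f y, rk_space f -> D y ->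
    f y = rk_ip f (fun x => K x y) }.

Definition rk_norm (R : realType) (T : Type) (D : set T) (K : T -> T -> R[i])
    (H : rkhs D K) (f : T -> R[i]) : R :=
  Num.sqrt (complex.Re (rk_ip H f f)).

Definition unit_cube (R : realType) (d : nat) : set (d.-tuple R) :=
  [set x | forall j : 'I_d, 0 <= tnth x j <= 1].

Definition cube_cons (R : realType) (d : nat)
    (x : measurableTypeR R * d.-tuple (measurableTypeR R)) :
  d.+1.-tuple (measurableTypeR R) := [tuple of x.1 :: x.2].

Lemma measurable_cube_cons (R : realType) (d : nat) :
  measurable_fun [set: measurableTypeR R * d.-tuple (measurableTypeR R)] (@cube_cons R d).
Proof. exact: measurable_cons. Qed.

HB.instance Definition _ (R : realType) (d : nat) :=
  isMeasurableFun.Build _ _ _ _ (@cube_cons R d) (@measurable_cube_cons R d).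

(* Lebesgue measure on [0,1]^d, as a measure on R^d concentrated on the cube:
   the d-fold product of Lebesgue measure on [0,1]. *)
Fixpoint lebesgue_cube (R : realType) (d : nat) :
    probability (d.-tuple (measurableTypeR R)) R :=
  match d with
  | 0 => \d_([tuple] : 0.-tuple (measurableTypeR R))
  | d'.+1 => distribution (uniform_prob (@ltr01 R) \x lebesgue_cube R d')%E
               (@cube_cons R d')
  end.

Definition cube_integral (R : realType) (d : nat) (f : d.-tuple R -> R[i]) :
    R[i] :=
  Rintegral (lebesgue_cube R d) (@unit_cube R d) (fun x => complex.Re (f x))
  +i* Rintegral (lebesgue_cube R d) (@unit_cube R d) (fun x => complex.Im (f x)).

Definition expi (R : realType) (t : R) : R[i] := cos t +i* sin t.

Definition box_sum (R : realType) (d : nat) (F : d.-tuple int -> R[i])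
    (n : nat) : R[i] :=
  \sum_(k : d.-tuple 'I_(n.*2.+1)) F [tuple (tnth k j)%:Z - n%:Z | j < d].

(* Sum over Z^d as the limit of the sums over the boxes {-n, ..., n}^d; it is
   only used for absolutely convergent sums.  R[i] carries no topology in the
   library, hence the separate limits of real and imaginary parts. *)
Definition lattice_sum (R : realType) (d : nat) (F : d.-tuple int -> R[i]) :
    R[i] :=
  limn (fun n : nat => complex.Re (box_sum F n))
  +i* limn (fun n : nat => complex.Im (box_sum F n)).

Definition korobov_r1 (R : realType) (alpha g : R) (h : int) : R :=
  if h == 0 then 1 else g / (`|h|%N%:R `^ alpha).

Definition korobov_r (R : realType) (alpha : R) (gamma : nat -> R) (d : nat)
    (h : d.-tuple int) : R :=
  \prod_(j < d) korobov_r1 alpha (gamma j.+1) (tnth h j).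

Definition korobov_kernel (R : realType) (alpha : R) (gamma : nat -> R)
    (d : nat) (x y : d.-tuple R) : R[i] :=
  lattice_sum (fun h : d.-tuple int => (korobov_r alpha gamma h)%:C *
    expi (2 * pi * \sum_(j < d) (tnth h j)%:~R * (tnth x j - tnth y j))).

Definition korobov_space (R : realType) (alpha : R) (gamma : nat -> R)
    (d : nat) :=
  rkhs (@unit_cube R d) (@korobov_kernel R alpha gamma d).

Definition fractional_part (R : realType) (x : R) : R := x - (Num.floor x)%:~R.

Definition lattice_point (R : realType) (N d : nat) (z : d.-tuple nat)
    (k : nat) : d.-tuple R :=
  [tuple fractional_part ((k * tnth z j)%N%:R / N%:R) | j < d].

Definition integration_error (R : realType) (N d : nat) (z : d.-tuple nat)
    (f : d.-tuple R -> R[i]) : R[i] :=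
  cube_integral f - N%:R^-1 * \sum_(k < N) f (lattice_point R N z k).

(* The error functional is bounded on H, so that this sup of reals is a true
   supremum; a complex modulus is real, whence the real part. *)
Definition worst_case_error (R : realType) (alpha : R) (gamma : nat -> R)
    (N d : nat) (H : korobov_space alpha gamma d) (z : d.-tuple nat) : R :=
  sup [set complex.Re `|integration_error N z f| |
         f in [set f | rk_space H f /\ rk_norm H f <= 1]].

Definition coprime_residues (N : nat) : {set 'I_N} :=
  [set z : 'I_N | (1 <= z <= N - 1)%N && coprime z N]%SET.

Definition reduced_search_space (b m w : nat) : {set 'I_(b ^ m)} :=
  if (w < m)%N
  then [set z : 'I_(b ^ m) | (1 <= z <= b ^ (m - w) - 1)%N && coprime z (b ^ m)]%SET
  else [set z : 'I_(b ^ m) | z == 1%N :> nat]%SET.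

Definition components (zt : nat -> nat) (d : nat) : d.-tuple nat :=
  [tuple zt j.+1 | j < d].

(* The outcome of a run; the exclusion sets E are those chosen during the run,
   so that quantifying over all E, z, zt covers adaptive choices of E and all
   ways of breaking ties in the minimisation. *)
Definition combined_cbc (R : realType) (alpha : R) (gamma : nat -> R)
    (H : forall d, korobov_space alpha gamma d) (b m : nat) (w : nat -> nat)
    (s : nat) (E : nat -> {set 'I_(b ^ m)}) (z : nat -> 'I_(b ^ m))
    (zt : nat -> nat) : Prop :=
  let Z d := reduced_search_space b m (w d) in
  let e2 d x := worst_case_error (b ^ m) (H d.+1)
                  [tuple of rcons (components zt d) (b ^ w d.+1 * x)%N] ^+ 2 in
  [/\ z 1%N = 1%N :> nat, zt 1%N = 1%N, E 1%N = finset.set0 &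
      forall d : nat, (1 <= d < s)%N ->
      if (w d.+1 < m)%N then
        [/\ E d.+1 \proper Z d.+1,
            z d.+1 \in Z d.+1 :\: E d.+1,
            forall x : 'I_(b ^ m), x \in Z d.+1 :\: E d.+1 ->
              e2 d (z d.+1) <= e2 d x &
            zt d.+1 = (b ^ w d.+1 * z d.+1)%N]
      else
        [/\ E d.+1 = finset.set0, z d.+1 = 0%N :> nat & zt d.+1 = 0%N]].

Definition aux_exclusion (b m : nat) (w : nat -> nat)
    (E : nat -> {set 'I_(b ^ m)}) (j : nat) : {set 'I_(b ^ m)} :=
  (coprime_residues (b ^ m) :\: reduced_search_space b m (w j)) :|: E j.

(* Main.v *)
(** The kernel is a product of one-dimensional even kernels, so every sum over
    Z^d factors.  Riemann sums over the grid with n points per axis converge to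
    the integral of every function of the space, and for N | n the difference
    of the grid rule and the lattice rule has a representer of squared norm
    (lattice mean of the kernel) - (grid mean of the kernel); letting n grow,
    e^2(z) = (lattice mean of the kernel) - 1.

    Expanding this mean, e^2(z) + 1 is a limit of finite sums over the dual
    lattice, and appending a component v adds theta(v), the part with nonzero
    last frequency.  Since (x + y)^lambda <= x^lambda + y^lambda, theta^lambda
    is at most the same sum with gamma^lambda and alpha lambda in place of
    gamma and alpha.  Summed over the whole search space, that is at most
    2 zeta(alpha lambda) gamma^lambda times the sum over all frequencies of the
    previous components, because for each residue a the weighted number of
    solutions (h, x) of h b^w x = a mod N is at most zeta(alpha lambda).  The
    minimiser over the non-excluded part of the search space is no worse than
    the average there, and the bound follows by induction on d. *)
Require Import Defs.
From HB Require Import structures.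
From mathcomp Require Import all_boot all_order all_algebra.
From mathcomp Require Import complex.
From mathcomp Require Import all_classical all_reals all_analysis.
From mathcomp Require Import measurable_realfun ring lra.
Set Implicit Arguments.
Unset Strict Implicit.
Unset Printing Implicit Defensive.
Import Order.TTheory GRing.Theory Num.Theory.
Import numFieldNormedType.Exports.
Local Open Scope classical_set_scope.
Local Open Scope ring_scope.
Local Open Scope complex_scope.

(** * Zeta partial sums and cosine sums *)

Section Pseries.
Context {R : realType}.

Definition pterm (s : R) (h : nat) : R := h.+1%:R `^ (- s).

Lemma pterm_gt0 (s : R) h : 0 < pterm s h.
Proof. by rewrite powR_gt0. Qed.

Lemma pterm_ge0 (s : R) h : 0 <= pterm s h.
Proof. exact/ltW/pterm_gt0. Qed.

Lemma ptermM (s : R) g h : (g.+1 * h.+1)%N%:R `^ (- s) = pterm s g * pterm s h.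
Proof. by rewrite natrM powRM. Qed.

Lemma pterm_le (s : R) g h : 0 <= s -> (g <= h)%N -> pterm s h <= pterm s g.
Proof.
move=> s0 gh; rewrite /pterm !powRN lef_pV2 ?posrE ?powR_gt0//.
by apply: ge0_ler_powR; rewrite // ?nnegrE ?ler_nat.
Qed.

Lemma pseries_ge0 (s : R) n : 0 <= series (pterm s) n.
Proof. by apply: sumr_ge0 => i _; exact: pterm_ge0. Qed.

(* Splitting into odd and even indices, S_(2n+1) <= 1 + 2 * 2^-s * S_n. *)
Lemma pseries_double (s : R) n : 0 <= s ->
  series (pterm s) n.*2.+1 <= 1 + 2 * 2 `^ (- s) * series (pterm s) n.
Proof.
move=> s0; elim: n => [|n ih].
  rewrite /series /= big_nat1 big_geq// mulr0 addr0 /pterm.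
  by rewrite powR1.
rewrite doubleS /series /= big_nat_recr//= big_nat_recr//= [X in _ <= _ + _ *
  X]big_nat_recr//=.
rewrite mulrDr addrA -addrA; apply: lerD => //.
have e : pterm s n.*2.+1 = 2 `^ (- s) * pterm s n.
  by rewrite /pterm -powRM ?ler0n// -natrM; congr ((_%:R) `^ _); rewrite -doubleS
    -mul2n.
have : pterm s n.*2.+2 <= pterm s n.*2.+1 by exact: pterm_le.
rewrite e; lra.
Qed.

(** The odd-even splitting gives [S_n <= S_(2n+1) <= 1 + 2^(1-s) S_n], and since [2^(1-s) < 1] this
    can be solved for [S_n]. *)
Lemma pseries_bound (s : R) n : 1 < s ->
  series (pterm s) n <= (1 - 2 * 2 `^ (- s))^-1.
Proof.
move=> s1; have s0 : 0 <= s by lra.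
have e2 : 2 * 2 `^ (- s) = (2 `^ (s - 1))^-1 :> R.
  by rewrite -powRN opprB -[X in X * _]powRr1// -powRD// pnatr_eq0 implybT.
have c1 : 2 * 2 `^ (- s) < 1 :> R.
  rewrite e2 invf_lt1 ?powR_gt0// lt_neqAle eq_sym powR_eq1 negb_or negb_or.
  rewrite subr_eq0 (gt_eqF s1) ltNge ler0n (eqr_nat _ 2 1) /=.
  by rewrite -[leLHS](powRr0 2) ler_powR ?ler1n// subr_ge0 ltW.
have le : series (pterm s) n <= series (pterm s) n.*2.+1.
  apply: nondecreasing_series => //; first by move=> k _ _; exact: pterm_ge0.
  by rewrite -addnn -addSn leq_addl.
have := le_trans le (pseries_double n s0).
rewrite -[_^-1]mul1r ler_pdivlMr ?subr_gt0//.
lra.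
Qed.

Lemma is_cvg_pseries (s : R) : 1 < s -> cvgn (series (pterm s)).
Proof.
move=> s1; apply: nondecreasing_is_cvgn.
  by apply: nondecreasing_series => k _ _; exact: pterm_ge0.
by exists (1 - 2 * 2 `^ (- s))^-1 => _ [n _ <-]; exact: pseries_bound.
Qed.

Lemma pseries_le_zeta (s : R) n : 1 < s -> series (pterm s) n <= zeta s.
Proof.
move=> s1; apply: (nondecreasing_cvgn_le _ (is_cvg_pseries s1)).
by apply: nondecreasing_series => k _ _; exact: pterm_ge0.
Qed.

Lemma zeta_ge0 (s : R) : 1 < s -> 0 <= zeta s.
Proof. by move=> s1; apply: le_trans (pseries_le_zeta 0 s1); exact: pseries_ge0. Qed.

(** Substitute [h + 1 = (g + 1)(k + 1)]: powers are multiplicative, and [k + 1] runs up to the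
    quotient of [n] by [g + 1]. *)
Lemma pseries_dvd (s : R) g n :
  \sum_(0 <= h < n | (g.+1 %| h.+1)%N) pterm s h =
  pterm s g * series (pterm s) (n %/ g.+1)%N.
Proof.
elim: n => [|n ih]; first by rewrite div0n /series /= !big_geq// mulr0.
rewrite big_mkcond big_nat_recr//= -big_mkcond ih divnS//.
case: ifP => [/dvdnP[k e]|_]; last by rewrite addr0.
have -> : (n %/ g.+1 = k.-1)%N.
  case: k e => [//|k] e.
  have -> : n = (k * g.+1 + g)%N.
    by apply: succn_inj; rewrite e mulSn addSn addnC.
  by rewrite divnMDl// (divn_small (ltnSn g)) addn0.
case: k e => [//|k] e /=.
rewrite /series /= big_nat_recr//= mulrDr; congr (_ + _).
by rewrite /pterm e mulnC ptermM.
Qed.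

Lemma pseries_dvd_le (s : R) g n : 1 < s ->
  \sum_(0 <= h < n | (g.+1 %| h.+1)%N) pterm s h <= pterm s g * zeta s.
Proof.
by move=> s1; rewrite pseries_dvd ler_wpM2l ?pterm_ge0 ?pseries_le_zeta.
Qed.

End Pseries.

(** * Orthogonality of the characters of Z/n, in real form *)

Section Trig.
Context {R : realType}.
Local Notation tau := (2 * pi : R).

Lemma tauE : tau = pi *+ 2. Proof. by rewrite mulr_natl. Qed.

Lemma cosDint (x : R) (i : int) : cos (x + tau * i%:~R) = cos x.
Proof.
have N n y : cos (y + tau * n%:R) = cos y.
  by rewrite mulr_natr tauE; apply: periodicn; exact: cosD2pi.
case: i => n; first exact: N.
by rewrite NegzE mulrNz mulrN -{1}[x]opprK -opprD cosN -[RHS]cosN N.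
Qed.

Lemma sinDint (x : R) (i : int) : sin (x + tau * i%:~R) = sin x.
Proof. by rewrite -!cosBpihalf addrAC cosDint. Qed.

Lemma cos_tau_int (i : int) : cos (tau * i%:~R) = 1 :> R.
Proof. by rewrite -[tau * _]add0r cosDint cos0. Qed.

Lemma sin_tau_int (i : int) : sin (tau * i%:~R) = 0 :> R.
Proof. by rewrite -[tau * _]add0r sinDint sin0. Qed.

Lemma cos_tau_lt1 (x : R) : 0 < x < 1 -> cos (tau * x) < 1.
Proof.
move=> /andP[x0 x1].
have -> : tau * x = (pi * x) *+ 2 by rewrite -mulr_natl; ring.
have s0 : 0 < sin (pi * x).
  apply: sin_gt0_pi; rewrite mulr_gt0 ?pi_gt0//=.
  by rewrite -[ltRHS]mulr1 ltr_pM2l ?pi_gt0.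
rewrite cos_mulr2n cos2sin2; have := exprn_gt0 2 s0; lra.
Qed.

(** By periodicity only the remainder of [i] modulo [n] matters; a nonzero remainder gives an angle
    strictly between 0 and a full turn, where the cosine is below 1. *)
Lemma cos_tau_frac (n : nat) (i : int) : (0 < n)%N ->
  cos (tau * (i%:~R / n%:R)) = 1 :> R -> (n%:Z %| i)%Z.
Proof.
move=> n0; have nR : n%:R != 0 :> R by rewrite pnatr_eq0 -lt0n.
have -> : tau * (i%:~R / n%:R) =
    tau * ((modz i n)%:~R / n%:R) + tau * (divz i n)%:~R :> R.
  by rewrite {1}(divz_eq i n) intrD intrM -pmulrn; field.
rewrite cosDint => c1.
apply/dvdz_mod0P/eqP; move/eqP: c1; apply: contraTT => m0.
have m_ge0 : (0 <= modz i n)%R by apply: modz_ge0; rewrite eqz_nat -lt0n.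
rewrite (lt_eqF (cos_tau_lt1 _))// divr_gt0 ?ltr0n//=; last by rewrite ltr0z lt_def m0.
by rewrite ltr_pdivrMr ?ltr0n// mul1r pmulrn ltr_int ltz_pmod// ltz_nat.
Qed.

(** The two sums are the real and imaginary parts of a geometric sum of roots of unity. Rotation by
    one step permutes its terms cyclically, so it vanishes unless the rotation is trivial. *)
Lemma sum_expi (n : nat) (i : int) : (0 < n)%N ->
  (\sum_(k < n) cos (tau * (i%:~R * k%:R / n%:R)) = (n * (n%:Z %| i)%Z)%N%:R :> R) /\
  \sum_(k < n) sin (tau * (i%:~R * k%:R / n%:R)) = 0 :> R.
Proof.
move=> n0; have nR : n%:R != 0 :> R by rewrite pnatr_eq0 -lt0n.
case: (boolP (n%:Z %| i)%Z) => [/dvdzP[q e]|ndvd].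
  have h k : i%:~R * k%:R / n%:R = (q * k%:Z)%:~R :> R.
    by rewrite e !intrM -!pmulrn; field.
  split; first under eq_bigr do rewrite h cos_tau_int.
    by rewrite sumr_const card_ord muln1.
  by apply: big1 => k _; rewrite h sin_tau_int.
set c := \sum_(k < n) cos _; set s := \sum_(k < n) sin _.
pose t : R := tau * (i%:~R / n%:R).
have tk k : tau * (i%:~R * k%:R / n%:R) = t *+ k by rewrite -mulr_natr /t; ring.
have ptn : t *+ n = tau * i%:~R.
  by rewrite /t -mulr_natr; field.
have shift (f : R -> R) : f (t *+ n) = f 0 ->
    \sum_(k < n) f (t *+ k.+1) = \sum_(k < n) f (tau * (i%:~R * k%:R / n%:R)).
  move=> fn; under [RHS]eq_bigr do rewrite tk.
  apply: (addrI (f 0)); rewrite -[in LHS](mulr0n t).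
  by rewrite -(big_ord_recl n (fun k => f (t *+ k))) big_ord_recr/= fn addrC.
have eqc : c = c * cos t - s * sin t.
  rewrite {1}/c -shift; last by rewrite ptn cos_tau_int cos0.
  rewrite /c /s !mulr_suml -sumrB; apply: eq_bigr => k _.
  by rewrite tk mulrSr cosD.
have eqs : s = s * cos t + c * sin t.
  rewrite {1}/s -shift; last by rewrite ptn sin_tau_int sin0.
  rewrite /c /s !mulr_suml -big_split; apply: eq_bigr => k _ /=.
  by rewrite tk mulrSr sinD mulrC; ring.
have ct1 : 1 - cos t != 0.
  rewrite subr_eq0; apply: contra ndvd => /eqP ct; exact: (cos_tau_frac n0 (esym ct)).
have cs := cos2Dsin2 t.
(* [eqc] and [eqs] form a linear system in [c] and [s] with determinant
   [(1 - cos t)^2 + sin^2 t = 2 (1 - cos t)], which is nonzero. *)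
have kc : c * (1 - cos t) * 2 = 0.
  have : c * (1 - cos t) = - (s * sin t) by lra.
  have : s * (1 - cos t) = c * sin t by lra.
  nra.
have ks : s * (1 - cos t) * 2 = 0.
  have : c * (1 - cos t) = - (s * sin t) by lra.
  have : s * (1 - cos t) = c * sin t by lra.
  nra.
have {kc}c0 : c = 0.
  by apply/eqP; move/eqP: kc; rewrite !mulf_eq0 (negbTE ct1) pnatr_eq0 !orbF.
have {ks}s0 : s = 0.
  by apply/eqP; move/eqP: ks; rewrite !mulf_eq0 (negbTE ct1) pnatr_eq0 !orbF.
by rewrite c0 s0 muln0.
Qed.

(** The shift by [j / n] only rotates the character sum: by whole turns if [n] divides [i], and
    otherwise the sum is zero anyway. *)
Lemma sum_cos_grid (n : nat) (i j : int) : (0 < n)%N ->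
  \sum_(k < n) cos (tau * (i%:~R * ((j%:~R - k%:R) / n%:R))) =
  (n * (n%:Z %| i)%Z)%N%:R :> R.
Proof.
move=> n0; have nR : n%:R != 0 :> R by rewrite pnatr_eq0 -lt0n.
have [sc ss] := @sum_expi n i n0.
transitivity (\sum_(k < n)
   (cos (tau * (i%:~R * j%:~R / n%:R)) * cos (tau * (i%:~R * k%:R / n%:R)) +
    sin (tau * (i%:~R * j%:~R / n%:R)) * sin (tau * (i%:~R * k%:R / n%:R)))).
  by apply: eq_bigr => k _; rewrite -cosB; congr cos; field.
rewrite big_split/= -!mulr_sumr sc ss mulr0 addr0.
case: (boolP (n%:Z %| i)%Z) => [/dvdzP[q ->]|_]; last by rewrite muln0 mulr0.
rewrite (_ : _ / n%:R = (q * j)%:~R) ?cos_tau_int ?mul1r//.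
by rewrite !intrM -pmulrn; field.
Qed.

End Trig.

(** * The one-dimensional kernel *)

Section BigCvg.
Context {R : realType} {I T : Type} (F : set_system T) {FF : Filter F}.

Lemma cvg_sumr (r : seq I) (P : pred I) (f : I -> T -> R) (l : I -> R) :
  (forall i, P i -> f i x @[x --> F] --> l i) ->
  \sum_(i <- r | P i) f i x @[x --> F] --> \sum_(i <- r | P i) l i.
Proof. by apply: cvg_big => //; exact: add_continuous. Qed.

Lemma cvg_prodr (r : seq I) (P : pred I) (f : I -> T -> R) (l : I -> R) :
  (forall i, P i -> f i x @[x --> F] --> l i) ->
  \prod_(i <- r | P i) f i x @[x --> F] --> \prod_(i <- r | P i) l i.
Proof. by apply: cvg_big => //; exact: mul_continuous. Qed.

End BigCvg.

Section Kap.
Context {R : realType}.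
Local Notation tau := (2 * pi : R).

(* The one-dimensional factor of the Korobov kernel, a function of x - y, with
   the frequencies h and - h grouped; the sum index h stands for h + 1. *)
Definition kernel1n (a g : R) (n : nat) (t : R) : R :=
  1 + 2 * g * \sum_(0 <= h < n) pterm a h * cos (tau * (h.+1%:R * t)).

Definition kernel1 (a g t : R) : R := limn (fun n => kernel1n a g n t).

(* The mean of kernel1 over the grid {0, 1/n, ..., (n-1)/n}: only frequencies
   divisible by n survive. *)
Definition grid_mean1 (a g : R) (n : nat) : R :=
  limn (fun M => 1 + 2 * g * \sum_(0 <= h < M | (n %| h.+1)%N) pterm a h).

Lemma kernel1nN a g n (t : R) : kernel1n a g n (- t) = kernel1n a g n t.
Proof.
congr (_ + _ * _); apply: eq_bigr => h _.
by rewrite !mulrN cosN.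
Qed.

Lemma kernel1nDint a g n (t : R) (i : int) : kernel1n a g n (t + i%:~R) = kernel1n a
  g n t.
Proof.
congr (_ + _ * _); apply: eq_bigr => h _.
have -> : tau * (h.+1%:R * (t + i%:~R)) = tau * (h.+1%:R * t) + tau * (h.+1%:Z * i)%:~R.
  by rewrite intrM -pmulrn; ring.
by rewrite cosDint.
Qed.

Lemma kernel1N a g (t : R) : kernel1 a g (- t) = kernel1 a g t.
Proof. by rewrite /kernel1; under eq_fun do rewrite kernel1nN. Qed.

Lemma kernel1Dint a g (t : R) (i : int) : kernel1 a g (t + i%:~R) = kernel1 a g t.
Proof. by rewrite /kernel1; under eq_fun do rewrite kernel1nDint. Qed.

Lemma pterm_cos_abs a h (t : R) : `|pterm a h * cos t| <= pterm a h.
Proof. by rewrite normrM ger0_norm ?pterm_ge0// ler_piMr ?pterm_ge0 ?cos_max. Qed.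

Section Conv.
Variables (a g : R).
Hypotheses (a1 : 1 < a) (g0 : 0 <= g).

Lemma kernel1n_cvg t : kernel1n a g n t @[n --> \oo] --> kernel1 a g t.
Proof.
suff : cvgn (fun n => kernel1n a g n t) by [].
apply: is_cvgD; first exact: is_cvg_cst.
apply: is_cvgM; first exact: is_cvg_cst.
apply: (@normed_cvg _ R (fun h => pterm a h * cos (tau * (h.+1%:R * t)))).
apply: (series_le_cvg _ _ _ (is_cvg_pseries a1)) => n //=; first exact: pterm_ge0.
exact: pterm_cos_abs.
Qed.

Lemma kernel1n_tail n m t : (m <= n)%N ->
  `|kernel1n a g n t - kernel1n a g m t| <= 2 * g * (series (pterm a) n - series
    (pterm a) m).
Proof.
move=> mn; rewrite /kernel1n opprD addrACA subrr add0r -mulrBr normrM ger0_norm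
  ?mulr_ge0//.
rewrite ler_wpM2l ?mulr_ge0// /series /= (big_cat_nat (leq0n m) mn)//= addrAC subrr
  add0r.
rewrite [in leRHS](big_cat_nat (leq0n m) mn)//= [in leRHS]addrAC subrr add0r.
apply: le_trans (ler_norm_sum _ _ _) _; apply: ler_sum => h _.
exact: pterm_cos_abs.
Qed.

(** The bound does not depend on [t], so the truncations converge uniformly; continuity of [kernel1]
    rests on this. *)
Lemma kernel1_tail m t :
  `|kernel1 a g t - kernel1n a g m t| <= 2 * g * (zeta a - series (pterm a) m).
Proof.
have c : `|kernel1n a g n t - kernel1n a g m t| @[n --> \oo] --> `|kernel1 a g t -
  kernel1n a g m t|.
  by apply: cvg_norm; apply: cvgB; [exact: kernel1n_cvg|exact: cvg_cst].
rewrite -(cvg_lim (@Rhausdorff R) c); apply: limr_le; first exact: cvgP c.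
exists m => // n mn; apply: le_trans (kernel1n_tail t mn) _.
by rewrite ler_wpM2l ?mulr_ge0// lerB// pseries_le_zeta.
Qed.

Lemma kernel1n_continuous n : continuous (kernel1n a g n).
Proof.
move=> t; apply: cvgD; first exact: cvg_cst.
apply: cvgM; first exact: cvg_cst.
apply: cvg_sumr => h _; apply: cvgM; first exact: cvg_cst.
apply: continuous_comp; last exact: continuous_cos.
by apply: cvgM; [exact: cvg_cst|apply: cvgM; [exact: cvg_cst|exact: cvg_id]].
Qed.

Lemma kernel1_continuous : continuous (kernel1 a g).
Proof.
move=> t; apply/cvgrPdist_le => e e0.
have e3 : 0 < e / 3 by rewrite divr_gt0.
have tail : 2 * g * (zeta a - series (pterm a) n) @[n --> \oo] --> (0 : R).
  rewrite -[X in _ --> X](mulr0 (2 * g)) -(subrr (zeta a)).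
  apply: cvgM; first exact: cvg_cst.
  by apply: cvgB; [exact: cvg_cst|exact: is_cvg_pseries a1].
have /cvgrPdist_le/(_ _ e3)[M _ /(_ M (leqnn _))] := tail.
rewrite /= sub0r normrN => tM.
have {}tM : 2 * g * (zeta a - series (pterm a) M) <= e / 3 by exact: le_trans
  (ler_norm _) tM.
have /cvgrPdist_le/(_ _ e3) := @kernel1n_continuous M t.
apply: filterS => u hu.
have h1 := @kernel1_tail M t; have h2 := @kernel1_tail M u.
have -> : kernel1 a g t - kernel1 a g u = (kernel1 a g t - kernel1n a g M t) +
   (kernel1n a g M t - kernel1n a g M u) - (kernel1 a g u - kernel1n a g M u) by ring.
apply: le_trans (ler_normB _ _) _.
have := ler_normD (kernel1 a g t - kernel1n a g M t) (kernel1n a g M t - kernel1n a g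
  M u).
lra.
Qed.

Lemma grid_mean1_cvg n :
  1 + 2 * g * (\sum_(0 <= h < M | (n %| h.+1)%N) pterm a h) @[M --> \oo] -->
    grid_mean1 a g n.
Proof.
suff : cvgn (fun M => 1 + 2 * g * \sum_(0 <= h < M | (n %| h.+1)%N) pterm a h) by [].
apply: is_cvgD; first exact: is_cvg_cst.
apply: is_cvgM; first exact: is_cvg_cst.
apply: nondecreasing_is_cvgn.
  by apply: nondecreasing_series => k _ _; exact: pterm_ge0.
exists (zeta a) => _ [M _ <-]; apply: le_trans (pseries_le_zeta M a1).
by rewrite big_mkcond; apply: ler_sum => h _; case: ifP; rewrite ?pterm_ge0.
Qed.

Lemma grid_mean1_ge1 n : 1 <= grid_mean1 a g n.
Proof.
apply: limr_ge; first by apply: cvgP; exact: grid_mean1_cvg.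
apply: nearW => M; rewrite lerDl mulr_ge0 ?mulr_ge0//.
by apply: sumr_ge0 => h _; rewrite pterm_ge0.
Qed.

Lemma grid_mean1_le n : grid_mean1 a g n.+1 <= 1 + 2 * g * (pterm a n * zeta a).
Proof.
apply: limr_le; first by apply: cvgP; exact: grid_mean1_cvg.
apply: nearW => M; rewrite lerD2l ler_wpM2l ?mulr_ge0//.
exact: pseries_dvd_le.
Qed.

Lemma grid_mean1_cvg1 : grid_mean1 a g n @[n --> \oo] --> (1 : R).
Proof.
rewrite -cvg_shiftS /=.
have c : 1 + 2 * g * (pterm a n * zeta a) @[n --> \oo] --> (1 : R).
  rewrite -[X in _ --> X]addr0; apply: cvgD; first exact: cvg_cst.
  rewrite -[X in _ --> X](mulr0 (2 * g)); apply: cvgM; first exact: cvg_cst.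
  rewrite -[X in _ --> X](mul0r (zeta a)); apply: cvgM; last exact: cvg_cst.
  exact: cvg_series_cvg_0 (is_cvg_pseries a1).
apply: squeeze_cvgr (cvg_cst (1 : R)) c.
by apply: nearW => n; rewrite grid_mean1_ge1 grid_mean1_le.
Qed.

(** In each truncation the sums over grid and frequencies are exchanged; [sum_cos_grid] then keeps
    only the frequencies divisible by [n], whatever the shift [j]. *)
Lemma kernel1_grid n (j : int) : (0 < n)%N ->
  \sum_(k < n) kernel1 a g ((j%:~R - k%:R) / n%:R) = n%:R * grid_mean1 a g n.
Proof.
move=> n0.
have c : \sum_(k < n) kernel1n a g M ((j%:~R - k%:R) / n%:R) @[M --> \oo] -->
    \sum_(k < n) kernel1 a g ((j%:~R - k%:R) / n%:R).
  by apply: cvg_sumr => k _; exact: kernel1n_cvg.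
rewrite -(cvg_lim (@Rhausdorff R) c); apply: cvg_lim => //.
have e M : \sum_(k < n) kernel1n a g M ((j%:~R - k%:R) / n%:R) =
   n%:R * (1 + 2 * g * (\sum_(0 <= h < M | (n %| h.+1)%N) pterm a h)).
  rewrite /kernel1n big_split/= sumr_const card_ord [RHS]mulrDr [X in _ = X +
    _]mulr1; congr (_ + _).
  rewrite -mulr_sumr exchange_big/= [in RHS]mulrCA; congr (_ * _).
  rewrite [in RHS]big_mkcond mulr_sumr; apply: eq_bigr => h _.
  rewrite -mulr_sumr (@sum_cos_grid _ n h.+1 j)// mulrC.
  rewrite (_ : (n%:Z %| h.+1%:Z)%Z = (n %| h.+1)%N)//.
  by case: ifP; rewrite ?muln1 ?muln0 ?mul0r ?mulr0.
under eq_fun do rewrite e.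
by apply: cvgM; [exact: cvg_cst|exact: grid_mean1_cvg].
Qed.

End Conv.
End Kap.

(** * Factorisation of the Korobov kernel into one-dimensional kernels *)

Section Kernel.
Context {R : realType}.
Local Notation tau := (2 * pi : R).

Lemma expiD (x y : R) : expi (x + y) = expi x * expi y.
Proof. by rewrite /expi cosD sinD; simpc; rewrite (addrC (sin x * _)). Qed.

Lemma expi0 : expi (0 : R) = 1.
Proof. by rewrite /expi cos0 sin0. Qed.

Lemma expi_sum (I : Type) (r : seq I) (f : I -> R) :
  expi (\sum_(i <- r) f i) = \prod_(i <- r) expi (f i).
Proof. by apply: (big_morph _ expiD expi0). Qed.

Lemma expiDN (x : R) : expi x + expi (- x) = (2 * cos x)%:C.
Proof. by apply/eqP; rewrite eq_complex /= cosN sinN subrr -mulr2n mulr_natl !eqxx. Qed.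

Lemma sum_tuple_prod (T : comPzRingType) (d : nat) (J : finType) (f : 'I_d -> J -> T) :
  \sum_(k : d.-tuple J) \prod_(j < d) f j (tnth k j) = \prod_(j < d) \sum_i f j i.
Proof.
rewrite bigA_distr_bigA /=.
rewrite (reindex (fun h : {ffun 'I_d -> J} => [tuple h j | j < d])) /=.
  by apply: eq_bigr => h _; apply: eq_bigr => j _; rewrite tnth_mktuple.
exists (fun k : d.-tuple J => [ffun j => tnth k j]) => h _.
  by apply/ffunP => j; rewrite ffunE tnth_mktuple.
by apply: eq_from_tnth => j; rewrite tnth_mktuple ffunE.
Qed.

Lemma sum_symm (V : nmodType) (f : int -> V) n :
  \sum_(k < n.*2.+1) f (k%:Z - n%:Z) =
  f 0 + \sum_(0 <= h < n) (f h.+1%:Z + f (- h.+1%:Z)).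
Proof.
elim: n => [|n ih]; first by rewrite big_ord_recl big_ord0 big_geq// subrr !addr0.
rewrite doubleS big_ord_recl big_ord_recr/=.
rewrite (eq_bigr (fun k : 'I_n.*2.+1 => f (k%:Z - n%:Z))); last first.
  by move=> k _; congr f; rewrite /bump leq0n add1n !intS opprD addrACA subrr add0r.
rewrite ih big_nat_recr//= sub0r /bump leq0n add1n.
have -> : n.*2.+2%:Z - n.+1%:Z = n.+1%:Z.
  by rewrite -addnn -addSn -addnS PoszD addrK.
by rewrite addrC -!addrA; congr (_ + (_ + _)).
Qed.

Lemma korobov_box_sum1 (a g t : R) n :
  \sum_(k < n.*2.+1) (korobov_r1 a g (k%:Z - n%:Z))%:C *
    expi (tau * ((k%:Z - n%:Z)%:~R * t)) = (kernel1n a g n t)%:C.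
Proof.
rewrite (sum_symm (fun h => (korobov_r1 a g h)%:C * expi (tau * (h%:~R * t)))).
rewrite {1}/korobov_r1 eqxx mul0r mulr0 expi0 mul1r /kernel1n rmorphD rmorph1; congr
  (_ + _).
rewrite mulr_sumr rmorph_sum; apply: eq_bigr => h _ /=.
rewrite /korobov_r1 /= -mulrDr intrN !mulNr !mulrN expiDN -rmorphM /=; congr (_%:C).
by rewrite /pterm powRN -pmulrn; ring.
Qed.

Lemma box_sumE (a : R) gamma d (x y : d.-tuple R) n :
  box_sum (fun h : d.-tuple int => (korobov_r a gamma h)%:C *
    expi (tau * \sum_(j < d) (tnth h j)%:~R * (tnth x j - tnth y j))) n =
  (\prod_(j < d) kernel1n a (gamma j.+1) n (tnth x j - tnth y j))%:C.
Proof.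
transitivity (\prod_(j < d) (kernel1n a (gamma j.+1) n (tnth x j - tnth y j))%:C);
  last first.
  by rewrite rmorph_prod.
under [RHS]eq_bigr do rewrite -korobov_box_sum1.
rewrite -sum_tuple_prod; apply: eq_bigr => k _.
rewrite big_split/= -expi_sum -mulr_sumr /korobov_r rmorph_prod.
under eq_bigr do rewrite tnth_mktuple.
by congr (_ * expi (_ * _)); apply: eq_bigr => j _; rewrite tnth_mktuple.
Qed.

(** Every box sum is a real product of one-dimensional truncations, so the limit is taken factor by
    factor and the imaginary part is constantly 0. *)
Lemma korobov_kernelE (a : R) gamma d (x y : d.-tuple R) :
  1 < a -> (forall j, (1 <= j)%N -> 0 < gamma j) ->
  korobov_kernel a gamma x y =
  (\prod_(j < d) kernel1 a (gamma j.+1) (tnth x j - tnth y j))%:C.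
Proof.
move=> a1 g0; rewrite /korobov_kernel /lattice_sum.
under [in X in limn X +i* _]eq_fun do rewrite box_sumE /=.
under [in X in _ +i* limn X]eq_fun do rewrite box_sumE /=.
congr (_ +i* _); last exact: lim_cst.
by apply: cvg_lim => //; apply: cvg_prodr => j _; apply: kernel1n_cvg; rewrite //
  ltW// g0.
Qed.

End Kernel.

(** * Reproducing kernel Hilbert spaces *)

Section RKHS.
Context {R : realType} {T : eqType} {D : set T} {K : T -> T -> R[i]}.
Variable H : rkhs D K.

Definition sqmod (z : R[i]) : R := complex.Re z ^+ 2 + complex.Im z ^+ 2.

Lemma Re_normc (z : R[i]) : complex.Re `|z| = Num.sqrt (sqmod z).
Proof. by case: z => x y; rewrite normc_def. Qed.

Definition rk_sq (f : T -> R[i]) : R := complex.Re (rk_ip H f f).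

Lemma rk_ip_self f : rk_space H f -> rk_ip H f f = (rk_sq f)%:C.
Proof.
move=> Hf; have := rk_ip_ge0 Hf; rewrite /rk_sq; case: (rk_ip H f f) => x y.
by rewrite lecE /= => /andP[/eqP -> _].
Qed.

Lemma rk_sq_ge0 f : rk_space H f -> 0 <= rk_sq f.
Proof. by move=> Hf; have := rk_ip_ge0 Hf; rewrite rk_ip_self// (lecR 0). Qed.

Lemma rk_ip_linearr (a : R[i]) f g h :
  rk_space H f -> rk_space H g -> rk_space H h ->
  rk_ip H h (fun x => a * f x + g x) = a^* * rk_ip H h f + rk_ip H h g.
Proof.
move=> Hf Hg Hh; rewrite (rk_ip_conj (rk_lin a Hf Hg) Hh) rk_ip_linear//.
by rewrite rmorphD rmorphM (rk_ip_conj Hf Hh) (rk_ip_conj Hg Hh).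
Qed.

(** The squared norm of [f + t g] is nonnegative at [t = - <f, g> / A], with [A] close to the
    optimal choice [|g|^2]. *)
Lemma cauchy_schwarz f g : rk_space H f -> rk_space H g ->
  sqmod (rk_ip H f g) <= rk_sq f * rk_sq g.
Proof.
move=> Hf Hg; apply/ler_addgt0Pr => e e0.
have F0 := rk_sq_ge0 Hf; have G0 := rk_sq_ge0 Hg.
(* The added term keeps [A] positive even when [g] has norm 0, and in the end it costs at most
   [e]. *)
pose A := rk_sq g + e / (rk_sq f + 1).
have f1 : 0 < rk_sq f + 1 by lra.
have d0 : 0 < e / (rk_sq f + 1) by rewrite divr_gt0.
have A0 : 0 < A by rewrite /A; lra.
have An0 : A != 0 by rewrite gt_eqF.
have main t : 0 <= rk_sq (fun x => t * g x + f x).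
  by apply: rk_sq_ge0; exact: rk_lin.
have := main (- (rk_ip H f g) / A%:C).
rewrite /rk_sq rk_ip_linear// ?rk_ip_linearr//; try exact: rk_lin.
rewrite (rk_ip_conj Hf Hg) !rk_ip_self//.
case: (rk_ip H f g) => x y.
have -> : - (x +i* y) / A%:C = (- x / A) +i* (- y / A).
  apply: (mulIf (_ : A%:C != 0)); first by rewrite eq_complex /= gt_eqF.
  rewrite mulfVK; last by rewrite eq_complex /= gt_eqF.
  by apply/eqP; rewrite eq_complex /= !mulr0 subr0 add0r !divfK ?eqxx.
rewrite /sqmod; simpc => /=.
rewrite ?(mulr0,mul0r,addr0,subr0,add0r).
set a := rk_sq g; set F := rk_sq f => h.
have {h} : 0 <= F - (x ^+ 2 + y ^+ 2) / A * (2 - a / A).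
  by move: h; congr (0 <= _); field.
have aA : a / A <= 1 by rewrite ler_pdivrMr// mul1r /A; lra.
set q := (x ^+ 2 + y ^+ 2) / A.
have q0 : 0 <= q by apply: divr_ge0; [rewrite addr_ge0 ?sqr_ge0|exact: ltW].
have -> : x ^+ 2 + y ^+ 2 = q * A by rewrite /q divfK.
move=> h; have qF : q <= F by nra.
have : F * (e / (F + 1)) <= e.
  by rewrite mulrCA ler_piMr ?(ltW e0)// ler_pdivrMr// mul1r; lra.
have : q * A <= F * A by rewrite ler_wpM2r// ltW.
rewrite {2}/A mulrDr; lra.
Qed.

(* A list of (weight, node) pairs is a quadrature rule; rk_ip_representer says that
   representer is its Riesz representer. *)
Definition weighted_sum (s : seq (R * T)) (f : T -> R[i]) : R[i] :=
  \sum_(p <- s) p.1%:C * f p.2.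

Definition representer (s : seq (R * T)) (x : T) : R[i] := weighted_sum s (K x).

Lemma representer_space (s : seq (R * T)) :
  {in s, forall p, D p.2} -> rk_space H (representer s).
Proof.
elim: s => [|p s ih] Ds.
  suff -> : representer [::] = fun _ => 0 by exact: rk_zero.
  by apply/funext => x; rewrite /representer /weighted_sum big_nil.
have -> : representer (p :: s) = fun x => p.1%:C * K x p.2 + representer s x.
  by apply/funext => x; rewrite /representer /weighted_sum big_cons.
apply: rk_lin; first by apply: rk_kernel; apply: Ds; rewrite mem_head.
by apply: ih => q qs; apply: Ds; rewrite inE qs orbT.
Qed.

Lemma rk_ip0 h : rk_space H h -> rk_ip H h (fun _ => 0) = 0.
Proof.
move=> Hh; have := rk_ip_linearr 1 (rk_zero H) (rk_zero H) Hh.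
under eq_fun do rewrite mulr0 addr0.
by rewrite rmorph1 mul1r => /eqP; rewrite -subr_eq subrr => /eqP <-.
Qed.

Lemma rk_ip_representer (s : seq (R * T)) f : rk_space H f ->
  {in s, forall p, D p.2} -> rk_ip H f (representer s) = weighted_sum s f.
Proof.
move=> Hf; elim: s => [|p s ih] Ds.
  have -> : representer [::] = fun _ => 0.
    by apply/funext => x; rewrite /representer /weighted_sum big_nil.
  by rewrite rk_ip0// /weighted_sum big_nil.
have Dp : D p.2 by apply: Ds; rewrite mem_head.
have Ds' : {in s, forall p, D p.2} by move=> q qs; apply: Ds; rewrite inE qs orbT.
have -> : representer (p :: s) = fun x => p.1%:C * K x p.2 + representer s x.
  by apply/funext => x; rewrite /representer /weighted_sum big_cons.
rewrite rk_ip_linearr//; [|exact: rk_kernel|exact: representer_space].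
rewrite ih// -rk_reproducing// /weighted_sum big_cons; congr (_ * _ + _).
by apply/eqP; rewrite eq_complex /= oppr0 !eqxx.
Qed.

(** Cauchy-Schwarz against the Riesz representer, whose squared norm is the rule applied to the
    representer itself. *)
Lemma weighted_sum_bound (s : seq (R * T)) f : rk_space H f ->
  {in s, forall p, D p.2} ->
  sqmod (weighted_sum s f) <= rk_sq f * complex.Re (weighted_sum s (representer s)).
Proof.
move=> Hf Ds; rewrite -rk_ip_representer//.
have := cauchy_schwarz Hf (representer_space Ds).
by rewrite /rk_sq (rk_ip_representer (representer_space Ds)).
Qed.

End RKHS.

(** * Riemann sums on the unit cube *)

Section Riemann.
Context {R : realType}.

(** Half-open on the right, except that the last cell is closed, so that the [m] cells partition
    [[0, 1]]. *)
Definition cell (m k : nat) : set R :=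
  [set` Interval (BLeft (k%:R / m%:R)) (BSide (k.+1 < m)%N (k.+1%:R / m%:R))].

Definition cell_box (d m : nat) (k : d.-tuple 'I_m) : set (d.-tuple R) :=
  [set x | forall j, cell m (tnth k j) (tnth x j)].

Definition grid_point (d m : nat) (k : d.-tuple 'I_m) : d.-tuple R :=
  [tuple (tnth k j)%:R / m%:R | j < d].

Lemma cellP m k (x : R) : (k < m)%N -> cell m k x ->
  [/\ k%:R / m%:R <= x, x <= k.+1%:R / m%:R & (k.+1 < m)%N -> x < k.+1%:R / m%:R].
Proof.
move=> km; rewrite /cell /= in_itv /=; case: ltnP => h /andP[-> xk]; split=> //.
exact: ltW.
Qed.

Lemma cell01 m k (x : R) : (k < m)%N -> cell m k x -> 0 <= x <= 1.
Proof.
move=> km /(cellP km)[h1 h2 _]; apply/andP; split; first exact: le_trans h1.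
by apply: le_trans h2 _; rewrite ler_pdivrMr ?mul1r ?ler_nat// ltr0n (leq_ltn_trans _
  km).
Qed.

Lemma cell_uniq m k l (x : R) : (k < m)%N -> (l < m)%N ->
  cell m k x -> cell m l x -> k = l.
Proof.
wlog kl : k l / (k < l)%N.
  move=> h km lm ck cl; case: (ltngtP k l) => // kl; first exact: h.
  by apply/esym; exact: h.
move=> km lm /(cellP km)[_ _ /(_ (leq_ltn_trans kl lm)) h] /(cellP lm)[h' _ _].
have := le_lt_trans h' h; rewrite ltr_pM2r ?invr_gt0 ?ltr0n ?(leq_ltn_trans _ km)//.
by rewrite ltr_nat ltnS leqNgt kl.
Qed.

Lemma cell_exists m (x : R) : 0 <= x <= 1 -> exists k : 'I_m.+1, cell m.+1 k x.
Proof.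
move=> /andP[x0 x1].
have mx0 : 0 <= m.+1%:R * x by rewrite mulr_ge0.
have /andP[t1 t2] := truncn_itv mx0.
have m0 : 0 < m.+1%:R :> R by rewrite ltr0n.
case: (ltnP (Num.truncn (m.+1%:R * x)) m.+1) => tm.
  exists (Ordinal tm); rewrite /cell /= in_itv /= ler_pdivrMr// [x * _]mulrC t1 /=.
  by case: ltnP => _ /=; rewrite ?ltr_pdivlMr ?ler_pdivlMr// mulrC// ltW.
(* The truncation reaches [m + 1] only at [x = 1], which belongs to the last, closed cell. *)
exists ord_max; rewrite /cell /= in_itv /= ltnn /= divff ?gt_eqF// x1 andbT.
by rewrite ler_pdivrMr// mulrC; apply: le_trans t1; rewrite ler_nat ltnW.
Qed.

Lemma uniform_cell m k : (k < m)%N ->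
  uniform_prob (@ltr01 R) (cell m k) = (m%:R^-1)%:E.
Proof.
move=> km; rewrite /uniform_prob integral_uniform_pdf setIidl; last first.
  by move=> x /(cell01 km); rewrite /= in_itv.
rewrite (eq_integral (fun=> 1%:E)); last first.
  move=> x; rewrite inE => /(cell01 km) x01.
  by rewrite /uniform_pdf x01 subr0 invr1.
have m0 : 0 < m%:R :> R by rewrite ltr0n (leq_ltn_trans _ km).
rewrite integral_cst/=; last exact: measurable_itv.
rewrite mul1e lebesgue_measure_itv /= lte_fin.
rewrite ltr_pM2r ?invr_gt0// ltr_nat ltnSn -EFinB -mulrBl.
by rewrite -natrB// subSnn mul1r.
Qed.

Lemma measurable_cell m k : measurable (cell m k : set (measurableTypeR R)).
Proof. exact: measurable_itv. Qed.

Lemma measurable_box d (A : 'I_d -> set (measurableTypeR R)) :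
  (forall j, measurable (A j)) ->
  measurable ([set x | forall j, A j (tnth x j)] : set (d.-tuple (measurableTypeR R))).
Proof.
move=> mA.
have -> : [set x : d.-tuple (measurableTypeR R) | forall j, A j (tnth x j)] =
    \bigcap_(j in [set: 'I_d]) ((fun x => tnth x j) @^-1` A j).
  by apply/seteqP; split => x h j; [move=> _; exact: h|exact: h].
apply: fin_bigcap_measurable => // j _.
have := measurable_tnth (T := measurableTypeR R) j measurableT (mA j).
by rewrite setTI.
Qed.

(** Induction on [d]: pulled back along [cube_cons], a box is a rectangle, and the product measure
    factors. *)
Lemma lebesgue_cube_box d (A : 'I_d -> set (measurableTypeR R)) (c : R) :
  (forall j, measurable (A j)) ->
  (forall j, uniform_prob (@ltr01 R) (A j) = c%:E) ->
  lebesgue_cube R d [set x | forall j, A j (tnth x j)] = (c ^+ d)%:E.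
Proof.
elim: d A => [|d ih] A mA uA.
  rewrite expr0 (_ : [set x | _] = setT) ?probability_setT//.
  by apply/seteqP; split => // x _ [].
rewrite /= /distribution /pushforward.
have -> : @cube_cons R d @^-1` [set x | forall j, A j (tnth x j)] =
    A ord0 `*` [set x | forall j, A (lift ord0 j) (tnth x j)].
  apply/seteqP; split => [[x1 x2] /= h|[x1 x2] /= [h1 h2]].
    split; first by exact: (h ord0).
    by move=> j; have := h (lift ord0 j); rewrite /cube_cons tnthS.
  move=> j; case: (unliftP ord0 j) => [i ->|->]; last exact: h1.
  by rewrite /cube_cons tnthS.
have mA' := @measurable_box d (fun j => A (lift ord0 j)) (fun j => mA _).
have -> := product_measure1E (uniform_prob (@ltr01 R)) (lebesgue_cube R d) (mA ord0)
  mA'.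
rewrite exprS EFinM -(ih (fun j => A (lift ord0 j)))//.
by congr (_ * _)%E; exact: uA.
Qed.

Lemma lebesgue_cube_cell_box d m (k : d.-tuple 'I_m) :
  lebesgue_cube R d (cell_box k) = ((m%:R^-1) ^+ d)%:E.
Proof.
apply: (@lebesgue_cube_box d (fun j => cell m (tnth k j))) => j.
  exact: measurable_cell.
by apply: uniform_cell; exact: ltn_ord.
Qed.

Lemma measurable_cell_box d m (k : d.-tuple 'I_m) :
  measurable (cell_box k : set (d.-tuple (measurableTypeR R))).
Proof.
by apply: (@measurable_box d (fun j => cell m (tnth k j))) => j; exact: measurable_cell.
Qed.

Lemma measurable_unit_cube d :
  measurable (@unit_cube R d : set (d.-tuple (measurableTypeR R))).
Proof.
have -> : @unit_cube R d = [set x | forall j, (fun=> `[0, 1]%classic) j (tnth x j)].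
  by apply/seteqP; split => x h j; have := h j; rewrite /= in_itv.
by apply: (@measurable_box d (fun=> `[0, 1]%classic)) => j; exact: measurable_itv.
Qed.

Lemma cell_box_cube d m (k : d.-tuple 'I_m) : cell_box k `<=` @unit_cube R d.
Proof. by move=> x h j; apply: (cell01 _ (h j)); exact: ltn_ord. Qed.

Lemma cell_box_exists d m (x : d.-tuple R) : unit_cube x ->
  exists k : d.-tuple 'I_m.+1, cell_box k x.
Proof.
move=> h; have /choice[k hk] := fun j => cell_exists m (h j).
by exists [tuple k j | j < d] => j; rewrite tnth_mktuple.
Qed.

Lemma cell_box_uniq d m (k l : d.-tuple 'I_m) (x : d.-tuple R) :
  cell_box k x -> cell_box l x -> k = l.
Proof.
move=> hk hl; apply: eq_from_tnth => j; apply/val_inj.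
by apply: (cell_uniq _ _ (hk j) (hl j)); exact: ltn_ord.
Qed.

Lemma grid_point_cube d m (k : d.-tuple 'I_m) : @unit_cube R d (grid_point k).
Proof.
move=> j; rewrite tnth_mktuple divr_ge0//=.
have m0 : (0 < m)%N by apply: leq_ltn_trans (ltn_ord (tnth k j)).
by rewrite ler_pdivrMr ?ltr0n// mul1r ler_nat ltnW.
Qed.

Definition step_fun d (F : d.-tuple R -> R) m (x : d.-tuple R) : R :=
  \sum_(k : d.-tuple 'I_m) F (grid_point k) * \1_(cell_box k) x.

Lemma step_funE d (F : d.-tuple R -> R) m (k : d.-tuple 'I_m) x :
  cell_box k x -> step_fun F m x = F (grid_point k).
Proof.
move=> kx; rewrite /step_fun (bigD1 k)//= indicE mem_set// mulr1.
rewrite big1 ?addr0// => l lk; rewrite indicE memNset ?mulr0// => lx.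
by case/negP: lk; apply/eqP; exact: cell_box_uniq lx kx.
Qed.

Definition riemann_sum d (F : d.-tuple R -> R) m : R :=
  (m%:R^-1) ^+ d * \sum_(k : d.-tuple 'I_m) F (grid_point k).

Lemma integrable_step_term d (F : d.-tuple R -> R) m (k : d.-tuple 'I_m) :
  (lebesgue_cube R d).-integrable (@unit_cube R d)
    (fun x => (F (grid_point k) * \1_(cell_box k) x)%:E).
Proof.
under eq_fun do rewrite EFinM.
apply: integrableZl; first exact: measurable_unit_cube.
apply: (@integrableS _ _ _ _ setT); rewrite //; first exact: measurable_unit_cube.
apply: integrable_indic; exact: measurable_cell_box.
Qed.

Lemma integral_step_fun d (F : d.-tuple R -> R) m :
  (\int[lebesgue_cube R d]_(x in @unit_cube R d) (step_fun F m x)%:E)%E =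
  (riemann_sum F m)%:E.
Proof.
have mD := @measurable_unit_cube d.
rewrite /step_fun; under eq_integral do rewrite -sumEFin.
rewrite integral_sum//; last by move=> k; exact: integrable_step_term.
rewrite /riemann_sum mulr_sumr -sumEFin; apply: eq_bigr => k _.
under eq_integral do rewrite EFinM.
rewrite integralZl//; last first.
  apply: (@integrableS _ _ _ _ setT); rewrite //.
  apply: integrable_indic; exact: measurable_cell_box.
rewrite integral_indic//; last exact: measurable_cell_box.
rewrite (setIidl (@cell_box_cube _ _ _)) mulrC EFinM.
by congr (_ * _)%E; exact: lebesgue_cube_cell_box.
Qed.

(** Dominated convergence: the step functions sampled at the lower corners of the cells converge
    pointwise by sequential continuity, are bounded by [C], and integrate to the Riemann sums. *)
Lemma riemann_cvg d (F : d.-tuple R -> R) (C : R) :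
  (forall x, unit_cube x -> `|F x| <= C) ->
  (forall x (u : nat -> d.-tuple R), unit_cube x -> (forall n, unit_cube (u n)) ->
    (forall j, tnth (u n) j @[n --> \oo] --> tnth x j) -> F (u n) @[n --> \oo] --> F
      x) ->
  riemann_sum F n.+1 @[n --> \oo] --> Rintegral (lebesgue_cube R d) (@unit_cube R d) F.
Proof.
move=> FC Fc; have mD := @measurable_unit_cube d.
have pw x : unit_cube x -> step_fun F n.+1 x @[n --> \oo] --> F x.
  move=> Dx; pose k n := sval (cid (cell_box_exists n Dx)).
  have hk n : cell_box (k n) x by exact: svalP (cid (cell_box_exists n Dx)).
  have e n : step_fun F n.+1 x = F (grid_point (k n)) by exact: step_funE.
  under eq_fun do rewrite e.
  apply: Fc => // [n|j]; first exact: grid_point_cube.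
  (* In each coordinate the lower corner of the cell of [x] lies between [x - 1/(n+1)] and [x]. *)
  have c0 : tnth x j - harmonic n @[n --> \oo] --> tnth x j.
    by rewrite -[X in _ --> X]subr0; apply: cvgB; [exact: cvg_cst|exact: cvg_harmonic].
  apply: squeeze_cvgr c0 (cvg_cst (tnth x j)); apply: nearW => n.
  have [] := cellP (ltn_ord _) (hk n j); rewrite tnth_mktuple => -> h _.
  by rewrite andbT lerBlDr /= -[X in _ + X]mul1r -mulrDl natr1.
have F01 m x : unit_cube x -> `|step_fun F m.+1 x| <= C.
  move=> Dx; have [k hk] := cell_box_exists m Dx.
  by rewrite (step_funE F hk); apply: FC; exact: grid_point_cube.
have mstep m : measurable_fun (@unit_cube R d : set (d.-tuple (measurableTypeR R)))
    (step_fun F m).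
  apply: measurable_sum => k; apply: measurable_funM => //.
  by apply: measurable_indic; exact: measurable_cell_box.
(* Measurability of [F] is inherited from the step functions as their pointwise limit. *)
have mF : measurable_fun (@unit_cube R d : set (d.-tuple (measurableTypeR R))) F.
  by apply: (measurable_fun_cvg (h := fun n => step_fun F n.+1)) => [m|x Dx]; [exact:
    mstep|exact: pw].
have m1 n : measurable_fun (@unit_cube R d : set (d.-tuple (measurableTypeR R)))
    (fun x => (step_fun F n.+1 x)%:E) by apply/measurable_EFinP; exact: mstep.
have m2 : measurable_fun (@unit_cube R d : set (d.-tuple (measurableTypeR R)))
    (EFin \o F) by apply/measurable_EFinP.
have ptw : {ae lebesgue_cube R d, forall x, unit_cube x ->
    (step_fun F n.+1 x)%:E @[n --> \oo] --> (EFin \o F) x}.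
  by apply: aeW => x Dx; apply: cvg_EFin; [exact: nearW|exact: pw].
have dom : {ae lebesgue_cube R d, forall x n, unit_cube x ->
    (`|(step_fun F n.+1 x)%:E| <= (EFin \o cst C) x)%E}.
  by apply: aeW => x n Dx; rewrite /= lee_fin; exact: F01.
have ig := finite_measure_integrable_cst (lebesgue_cube R d) C mD.
have [intF _ cF] := dominated_convergence mD m1 m2 ptw ig dom.
rewrite /Rintegral; set I := (\int[_]_(_ in _) _)%E.
have If : I \is a fin_num by exact: integrable_fin_num intF.
suff /fine_cvg : (riemann_sum F n.+1)%:E @[n --> \oo] --> (fine I)%:E by [].
by rewrite fineK//; move: cF; under eq_fun do rewrite integral_step_fun.
Qed.

End Riemann.

(** * The worst-case error of a lattice rule *)

Section ComplexParts.
Context {R : realType}.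

Lemma Re_sum (I : Type) (r : seq I) (f : I -> R[i]) :
  complex.Re (\sum_(i <- r) f i) = \sum_(i <- r) complex.Re (f i).
Proof. by elim/big_rec2: _ => // i y [a b] _ <-; case: (f i). Qed.

Lemma Im_sum (I : Type) (r : seq I) (f : I -> R[i]) :
  complex.Im (\sum_(i <- r) f i) = \sum_(i <- r) complex.Im (f i).
Proof. by elim/big_rec2: _ => // i y [a b] _ <-; case: (f i). Qed.

Lemma Re_mulC (c : R) (z : R[i]) : complex.Re (c%:C * z) = c * complex.Re z.
Proof. by case: z => a b /=; rewrite mul0r subr0. Qed.

Lemma Im_mulC (c : R) (z : R[i]) : complex.Im (c%:C * z) = c * complex.Im z.
Proof. by case: z => a b /=; rewrite mul0r addr0. Qed.

Lemma ReB (z z' : R[i]) : complex.Re (z - z') = complex.Re z - complex.Re z'.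
Proof. by case: z z' => [a b] []. Qed.

Lemma ImB (z z' : R[i]) : complex.Im (z - z') = complex.Im z - complex.Im z'.
Proof. by case: z z' => [a b] []. Qed.

Lemma natrVC (n : nat) : (n%:R^-1 : R[i]) = (n%:R^-1)%:C.
Proof. by rewrite -[(_^-1)%:C]/(real_complex R _) fmorphV rmorph_nat. Qed.

End ComplexParts.

Section PeriodicSum.
Context {V : nmodType}.

(** Raising [k] by one permutes the residues cyclically: the new term at [l = 0] equals, by
    periodicity, the one lost at the other end. Evenness settles [k = 0]. *)
Lemma sum_periodic (phi : int -> V) (N k : nat) :
  (forall i, phi (i + N%:Z) = phi i) -> (forall i, phi (- i) = phi i) ->
  \sum_(l < N) phi (k%:Z - l%:Z) = \sum_(l < N) phi l%:Z.
Proof.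
case: N => [|N] per even; first by rewrite !big_ord0.
elim: k => [|k <-]; first by apply: eq_bigr => l _; rewrite sub0r even.
rewrite big_ord_recl [RHS]big_ord_recr/= addrC; congr (_ + _).
  by apply: eq_bigr => l _; congr phi; rewrite /bump leq0n add1n !intS opprD addrACA
    subrr add0r.
by rewrite subr0 -(per (k%:Z - N%:Z)); congr phi; rewrite !intS; ring.
Qed.

End PeriodicSum.

(** * Members of the Korobov space, and the squared worst-case error as a lattice mean *)

Section Korobov.
Context {R : realType}.
Variables (alpha : R) (gamma : nat -> R) (d : nat) (H : korobov_space alpha gamma d).
Hypothesis a1 : 1 < alpha.
Hypothesis g0 : forall j : nat, (1 <= j)%N -> 0 < gamma j.

Let D : set (d.-tuple R) := @unit_cube R d.
Let gj0 (j : 'I_d) : 0 <= gamma j.+1. Proof. by rewrite ltW// g0. Qed.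

Definition kernelR (x y : d.-tuple R) : R :=
  \prod_(j < d) kernel1 alpha (gamma j.+1) (tnth x j - tnth y j).

Lemma kernelR_sym x y : kernelR x y = kernelR y x.
Proof. by apply: eq_bigr => j _; rewrite -kernel1N opprB. Qed.

Lemma korobov_kernelR x y : korobov_kernel alpha gamma x y = (kernelR x y)%:C.
Proof. exact: korobov_kernelE. Qed.

Definition weighted_sumR (s : seq (R * d.-tuple R)) (F : d.-tuple R -> R) : R :=
  \sum_(p <- s) p.1 * F p.2.

Lemma Re_weighted_sum s (f : d.-tuple R -> R[i]) :
  complex.Re (weighted_sum s f) = weighted_sumR s (fun x => complex.Re (f x)).
Proof. by rewrite /weighted_sum Re_sum; apply: eq_bigr => p _; rewrite Re_mulC. Qed.

Lemma Im_weighted_sum s (f : d.-tuple R -> R[i]) :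
  complex.Im (weighted_sum s f) = weighted_sumR s (fun x => complex.Im (f x)).
Proof. by rewrite /weighted_sum Im_sum; apply: eq_bigr => p _; rewrite Im_mulC. Qed.

Local Notation lc s := (representer (K := @korobov_kernel R alpha gamma d) s).

Lemma representerE s x : lc s x = (weighted_sumR s (kernelR x))%:C.
Proof.
apply/eqP; rewrite eq_complex; apply/andP; split; apply/eqP.
  by rewrite /representer Re_weighted_sum; apply: eq_bigr => p _; rewrite
    korobov_kernelR.
by rewrite /representer Im_weighted_sum /weighted_sumR big1// => p _; rewrite
  korobov_kernelR/= mulr0.
Qed.

Lemma weighted_sum_bound_kernelR s f : rk_space H f -> {in s, forall p, D p.2} ->
  sqmod (weighted_sum s f) <= rk_sq H f * weighted_sumR s (fun x => weighted_sumR s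
    (kernelR x)).
Proof.
move=> Hf Ds; have := weighted_sum_bound Hf Ds; rewrite Re_weighted_sum.
by under eq_fun do rewrite representerE.
Qed.

Lemma weighted_sumR_cat s t F : weighted_sumR (s ++ t) F = weighted_sumR s F +
  weighted_sumR t F.
Proof. by rewrite /weighted_sumR big_cat. Qed.

Lemma kernelR_diag x : kernelR x x = \prod_(j < d) kernel1 alpha (gamma j.+1) 0.
Proof. by apply: eq_bigr => j _; rewrite subrr. Qed.

(** Evaluation at [x] is a one-node rule whose squared norm [K(x, x)] is the same for all [x]. *)
Lemma space_bounded f : rk_space H f ->
  exists C, forall x, D x -> `|complex.Re (f x)| <= C /\ `|complex.Im (f x)| <= C.
Proof.
move=> Hf; exists (Num.sqrt (rk_sq H f * \prod_(j < d) kernel1 alpha (gamma j.+1) 0))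
  => x Dx.
have Ds : {in [:: (1, x)], forall p : R * d.-tuple R, D p.2}.
  by move=> p; rewrite inE => /eqP ->.
have := weighted_sum_bound_kernelR Hf Ds; rewrite /weighted_sumR /weighted_sum
  !big_cons !big_nil /= !addr0 !mul1r kernelR_diag.
rewrite /sqmod => h; rewrite -!sqrtr_sqr.
by split; apply: ler_wsqrtr; apply: le_trans h; rewrite ?lerDl ?lerDr sqr_ge0.
Qed.

(** The difference [f(u_n) - f(x)] is a two-node rule of squared norm [2 (K(x, x) - K(x, u_n))],
    which tends to 0 by continuity of [kernel1]. *)
Lemma space_continuous f x (u : nat -> d.-tuple R) : rk_space H f ->
  D x -> (forall n, D (u n)) ->
  (forall j, tnth (u n) j @[n --> \oo] --> tnth x j) ->
  complex.Re (f (u n)) @[n --> \oo] --> complex.Re (f x) /\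
  complex.Im (f (u n)) @[n --> \oo] --> complex.Im (f x).
Proof.
move=> Hf Dx Du ux.
pose e n := rk_sq H f * (2 * (kernelR x x - kernelR x (u n))).
have fe n : sqmod (f (u n) - f x) <= e n.
  have Ds : {in [:: (1, u n); (- 1, x)], forall p : R * d.-tuple R, D p.2}.
    by move=> p; rewrite !inE => /orP[] /eqP -> //=; exact: Du.
  have := weighted_sum_bound_kernelR Hf Ds; rewrite /weighted_sumR /weighted_sum
    !big_cons !big_nil /= !addr0.
  rewrite rmorphN rmorph1 !mul1r !mulN1r /e => /le_trans; apply.
  rewrite (kernelR_sym (u n) x) (_ : kernelR (u n) (u n) = kernelR x x) ?kernelR_diag//.
  by rewrite le_eqVlt; apply/orP; left; apply/eqP; ring.
have ce : Num.sqrt (e n) @[n --> \oo] --> 0.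
  rewrite -sqrtr0; apply: continuous_cvg; first exact: sqrt_continuous.
  rewrite -(mulr0 (rk_sq H f)); apply: cvgM; first exact: cvg_cst.
  rewrite -(mulr0 2); apply: cvgM; first exact: cvg_cst.
  rewrite -(subrr (kernelR x x)); apply: cvgB; first exact: cvg_cst.
  apply: cvg_prodr => j _; apply: continuous_cvg; first exact: kernel1_continuous.
  by apply: cvgB; [exact: cvg_cst|exact: ux].
split; apply/cvgrPdist_le => eps eps0;
  have /cvgrPdist_le/(_ _ eps0) := ce; apply: filterS => n;
  rewrite sub0r normrN (ger0_norm (sqrtr_ge0 _)); apply: le_trans;
  rewrite distrC -?ReB -?ImB -sqrtr_sqr ler_wsqrtr//; apply: le_trans (fe n);
  by rewrite ?lerDl ?lerDr sqr_ge0.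
Qed.

Lemma cube_integral_cvg f : rk_space H f ->
  riemann_sum (fun x => complex.Re (f x)) n.+1 @[n --> \oo] --> complex.Re
    (cube_integral f) /\
  riemann_sum (fun x => complex.Im (f x)) n.+1 @[n --> \oo] --> complex.Im
    (cube_integral f).
Proof.
move=> Hf; have [C hC] := space_bounded Hf.
split; apply: (riemann_cvg (C := C)) => [x /hC[]//|x u Dx Du ux];
  by have [] := space_continuous Hf Dx Du ux.
Qed.

Definition on_grid (n : nat) (y : d.-tuple R) :=
  forall j, exists i : int, tnth y j = i%:~R / n%:R.

Lemma on_grid_dvd n n' y : (0 < n')%N -> (n %| n')%N -> on_grid n y -> on_grid n' y.
Proof.
move=> n'0 /dvdnP[q e] h j; have [i ->] := h j; exists (i * q%:Z).
have n0 : (0 < n)%N by move: n'0; rewrite e muln_gt0 => /andP[].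
have q0 : (0 < q)%N by move: n'0; rewrite e muln_gt0 => /andP[].
rewrite e natrM intrM -pmulrn; field.
by rewrite !pnatr_eq0 -!lt0n n0.
Qed.

Lemma on_grid_grid n (k : d.-tuple 'I_n) : on_grid n (grid_point k).
Proof. by move=> j; exists (tnth k j : nat)%:Z; rewrite tnth_mktuple. Qed.

Definition grid_mean (n : nat) : R := \prod_(j < d) grid_mean1 alpha (gamma j.+1) n.

Lemma grid_mean_ge1 n : 1 <= grid_mean n.
Proof.
rewrite /grid_mean; elim/big_ind: _ => // [x y x1 y1|j _]; last exact: grid_mean1_ge1.
by rewrite -[1]mulr1 ler_pM.
Qed.

Lemma grid_mean_cvg : grid_mean n @[n --> \oo] --> (1 : R).
Proof.
have -> : 1 = \prod_(j < d) (1 : R) by rewrite big1.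
by apply: cvg_prodr => j _; exact: grid_mean1_cvg1.
Qed.

(** The grid mean factors over the coordinates, and by [kernel1_grid] a shift by a grid point leaves
    each factor unchanged. *)
Lemma riemann_sum_kernelR n y : (0 < n)%N -> on_grid n y -> riemann_sum (kernelR y) n
  = grid_mean n.
Proof.
move=> n0 /choice[i hi]; rewrite /riemann_sum /kernelR.
transitivity (n%:R^-1 ^+ d * \sum_(k : d.-tuple 'I_n) \prod_(j < d)
   kernel1 alpha (gamma j.+1) (((i j)%:~R - (tnth k j)%:R) / n%:R)).
  congr (_ * _); apply: eq_bigr => k _; apply: eq_bigr => j _.
  by rewrite hi tnth_mktuple mulrBl.
rewrite (sum_tuple_prod (fun j (k : 'I_n) => kernel1 alpha (gamma j.+1) (((i j)%:~R -
  k%:R) / n%:R))).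
rewrite -[X in _ ^+ X](card_ord d) -prodr_const -big_split/=; apply: eq_bigr => j _.
by rewrite kernel1_grid// mulrA mulVf ?mul1r// pnatr_eq0 -lt0n.
Qed.

Section Lattice.
Variables (N : nat) (z : d.-tuple nat).
Hypothesis N0 : (0 < N)%N.

Local Notation xk := (@lattice_point R N d z).

Definition grid_rule n : seq (R * d.-tuple R) :=
  [seq ((n%:R^-1) ^+ d, grid_point k) | k <- index_enum (d.-tuple 'I_n)].
(** The weights are negative: appended to [grid_rule], this rule computes grid mean minus lattice
    mean. *)
Definition lattice_rule : seq (R * d.-tuple R) :=
  [seq (- (N%:R^-1), xk k) | k : 'I_N <- index_enum 'I_N].

(* The lattice mean of the kernel, i.e. 1 + e^2(z). *)
Definition lattice_mean : R :=
  N%:R^-1 * \sum_(k < N) \prod_(j < d) kernel1 alpha (gamma j.+1) ((k * tnth z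
    j)%N%:R / N%:R).

Lemma weighted_sumR_grid n F : weighted_sumR (grid_rule n) F = riemann_sum F n.
Proof. by rewrite /weighted_sumR big_map /= -mulr_sumr. Qed.

Lemma weighted_sumR_lattice F : weighted_sumR lattice_rule F = - (N%:R^-1 * \sum_(k <
  N) F (xk k)).
Proof. by rewrite /weighted_sumR big_map /= -mulr_sumr mulNr. Qed.

Lemma lattice_point_cube k : D (xk k).
Proof.
move=> j; rewrite tnth_mktuple /fractional_part subr_ge0 floor_le/=.
by rewrite lerBlDr ltW// addrC -intrD1 // lt_succ_floor.
Qed.

Lemma on_grid_lattice k : on_grid N (xk k).
Proof.
move=> j; rewrite tnth_mktuple /fractional_part; set f := Num.floor _.
exists ((k * tnth z j)%N%:Z - f * N%:Z).
rewrite intrB intrM -!pmulrn; field.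
by rewrite pnatr_eq0 -lt0n.
Qed.

(** The kernel between nodes [k] and [l] depends only on [k - l] modulo [N], the fractional parts
    being absorbed by periodicity; hence all [N] row sums agree. *)
Lemma lattice_mean_kernelR :
  \sum_(k < N) \sum_(l < N) kernelR (xk k) (xk l) = N%:R ^+ 2 * lattice_mean.
Proof.
pose phi (i : int) := \prod_(j < d) kernel1 alpha (gamma j.+1) (i%:~R * (tnth z j)%:R
  / N%:R).
have NR : N%:R != 0 :> R by rewrite pnatr_eq0 -lt0n.
have per i : phi (i + N%:Z) = phi i.
  apply: eq_bigr => j _.
  have -> : (i + N)%:~R * (tnth z j)%:R / N%:R =
      i%:~R * (tnth z j)%:R / N%:R + (tnth z j)%:Z%:~R :> R.
    by rewrite intrD -!pmulrn; field.
  by rewrite kernel1Dint.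
have even i : phi (- i) = phi i.
  by apply: eq_bigr => j _; rewrite intrN !mulNr kernel1N.
have e (k l : nat) : kernelR (xk k) (xk l) = phi (k%:Z - l%:Z).
  apply: eq_bigr => j _; rewrite !tnth_mktuple /fractional_part.
  set f := Num.floor _; set f' := Num.floor _.
  have -> : (k * tnth z j)%:R / N%:R - f%:~R - ((l * tnth z j)%:R / N%:R - f'%:~R) =
    (k%:Z - l%:Z)%:~R * (tnth z j)%:R / N%:R + (f' - f)%:~R :> R.
    by rewrite !intrB -!pmulrn !natrM; field.
  by rewrite kernel1Dint.
transitivity (\sum_(k < N) \sum_(l < N) phi l%:Z).
  apply: eq_bigr => k _; under eq_bigr do rewrite e.
  exact: (sum_periodic _ per even).
rewrite sumr_const card_ord /lattice_mean expr2 -mulrA mulVKf// -[LHS]mulr_natl.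
congr (_ * _); apply: eq_bigr => l _; apply: eq_bigr => j _.
by rewrite natrM -pmulrn.
Qed.

(* Replacing the integral by the mean over the n^d-point grid turns the error
   functional into a quadrature rule; its representer nearly maximises the error. *)
Definition error_rule n := grid_rule n ++ lattice_rule.

Lemma error_rule_grid n : (0 < n)%N -> (N %| n)%N -> {in error_rule n, forall p,
  on_grid n p.2}.
Proof.
move=> n0 Nn p; rewrite mem_cat => /orP[] /mapP[k _ ->] /=; first exact: on_grid_grid.
exact: on_grid_dvd (on_grid_lattice k).
Qed.

Lemma error_rule_cube n : {in error_rule n, forall p, D p.2}.
Proof.
move=> p; rewrite mem_cat => /orP[] /mapP[k _ ->] /=; first exact: grid_point_cube.
exact: lattice_point_cube.
Qed.

Lemma error_rule_sum n : (0 < n)%N -> \sum_(p <- error_rule n) p.1 = 0.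
Proof.
move=> n0; rewrite big_cat !big_map /= !sumr_const card_tuple !card_ord.
rewrite mulNrn -[X in X - _]mulr_natr -[X in _ - X]mulr_natr natrX -exprMn.
by rewrite !mulVf ?expr1n ?subrr// pnatr_eq0 -lt0n.
Qed.

(** All nodes lie on the finer grid, so their kernels share the grid mean [grid_mean n'], and the
    weights of the rule add up to 0. Letting [n'] grow shows that the representer has integral 0. *)
Lemma riemann_sum_error_rule n n' : (0 < n)%N -> (0 < n')%N -> (N %| n)%N -> (n %|
  n')%N ->
  riemann_sum (fun x => weighted_sumR (error_rule n) (kernelR x)) n' = 0.
Proof.
move=> n0 n'0 Nn nn'; rewrite /riemann_sum /weighted_sumR exchange_big mulr_sumr/=.
rewrite big_seq (eq_bigr (fun p => p.1 * grid_mean n')); last first.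
  move=> p ps; rewrite -mulr_sumr mulrCA; congr (_ * _).
  rewrite -(riemann_sum_kernelR n'0 (on_grid_dvd n'0 nn' (error_rule_grid n0 Nn ps))).
  by rewrite /riemann_sum; congr (_ * _); apply: eq_bigr => k _; exact: kernelR_sym.
by rewrite -big_seq -mulr_suml error_rule_sum// mul0r.
Qed.

Lemma lattice_error_rule n : (0 < n)%N -> (N %| n)%N ->
  weighted_sumR lattice_rule (fun x => weighted_sumR (error_rule n) (kernelR x)) =
    lattice_mean - grid_mean n.
Proof.
move=> n0 Nn; rewrite weighted_sumR_lattice.
have NR : N%:R != 0 :> R by rewrite pnatr_eq0 -lt0n.
under eq_bigr => k _.
  rewrite weighted_sumR_cat weighted_sumR_grid weighted_sumR_lattice.
  rewrite (riemann_sum_kernelR n0 (on_grid_dvd n0 Nn (@on_grid_lattice k))).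
  over.
rewrite big_split/= sumr_const card_ord sumrN -mulr_sumr lattice_mean_kernelR.
by rewrite -mulr_natr; field.
Qed.

Lemma error_rule_sqnorm n : (0 < n)%N -> (N %| n)%N ->
  weighted_sumR (error_rule n) (fun x => weighted_sumR (error_rule n) (kernelR x)) =
    lattice_mean - grid_mean n.
Proof. by move=> n0 Nn; rewrite weighted_sumR_cat weighted_sumR_grid
  riemann_sum_error_rule// add0r lattice_error_rule. Qed.

Lemma Re_integration_error f :
  complex.Re (integration_error N z f) =
  complex.Re (cube_integral f) + weighted_sumR lattice_rule (fun x => complex.Re (f x)).
Proof. by rewrite /integration_error ReB natrVC Re_mulC Re_sum weighted_sumR_lattice.
  Qed.

Lemma Im_integration_error f :
  complex.Im (integration_error N z f) =
  complex.Im (cube_integral f) + weighted_sumR lattice_rule (fun x => complex.Im (f x)).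
Proof. by rewrite /integration_error ImB natrVC Im_mulC Im_sum weighted_sumR_lattice.
  Qed.

(** The predecessor compensates for the index [n.+1] in [riemann_cvg]: along this subsequence the
    grid sizes are the positive multiples of [n]. *)
Definition multiples (n i : nat) := (n * i.+1).-1.

Lemma multiplesS n i : (0 < n)%N -> (multiples n i).+1 = (n * i.+1)%N.
Proof. by move=> n0; rewrite prednK// muln_gt0 n0. Qed.

Lemma multiples_cvg n : (0 < n)%N -> multiples n i @[i --> \oo] --> \oo.
Proof.
move=> n0; apply/cvgnyPge => A; exists A => // i /= Ai.
rewrite -ltnS multiplesS//; apply: leq_ltn_trans Ai _.
exact: leq_pmull.
Qed.

Lemma grid_mean_multiples : grid_mean (N * i.+1) @[i --> \oo] --> (1 : R).
Proof.
have c : grid_mean n.+1 @[n --> \oo] --> (1 : R) by rewrite (cvg_shiftS grid_mean);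
  exact: grid_mean_cvg.
have := cvg_comp _ _ (multiples_cvg N0) c.
by apply: cvg_trans; apply: near_eq_cvg; apply: nearW => i /=; rewrite multiplesS.
Qed.

Lemma cube_integral_multiples n f : (0 < n)%N -> rk_space H f ->
  riemann_sum (fun x => complex.Re (f x)) (n * i.+1) @[i --> \oo] --> complex.Re
    (cube_integral f) /\
  riemann_sum (fun x => complex.Im (f x)) (n * i.+1) @[i --> \oo] --> complex.Im
    (cube_integral f).
Proof.
move=> n0 Hf; have [cR cI] := cube_integral_cvg Hf.
split; [have := cvg_comp _ _ (multiples_cvg n0) cR|have := cvg_comp _ _
  (multiples_cvg n0) cI];
by apply: cvg_trans; apply: near_eq_cvg; apply: nearW => i /=; rewrite multiplesS.
Qed.

(** The error is the limit of the rules [error_rule (N * i.+1)] applied to [f], whose squared norms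
    are at most [lattice_mean - 1] because grid means are at least 1. *)
Lemma error_bound f : rk_space H f ->
  sqmod (integration_error N z f) <= rk_sq H f * (lattice_mean - 1).
Proof.
move=> Hf; have [cR cI] := cube_integral_multiples N0 Hf.
have c : sqmod (weighted_sum (error_rule (N * i.+1)) f) @[i --> \oo] --> sqmod
  (integration_error N z f).
  rewrite /sqmod; apply: cvgD; rewrite Re_integration_error || rewrite
    Im_integration_error;
    under eq_fun do rewrite ?Re_weighted_sum ?Im_weighted_sum weighted_sumR_cat
      weighted_sumR_grid;
    by apply: cvgM; apply: cvgD => //; exact: cvg_cst.
apply: cvgr_to_le c _; apply: nearW => i.
have n0 : (0 < N * i.+1)%N by rewrite muln_gt0 N0.
apply: le_trans (weighted_sum_bound_kernelR Hf (@error_rule_cube _)) _.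
rewrite error_rule_sqnorm ?dvdn_mulr//.
by rewrite ler_wpM2l ?rk_sq_ge0// lerD2l lerN2 grid_mean_ge1.
Qed.

(** The integral of the representer is the limit of its Riemann sums over multiples of [n], all
    zero; only the lattice part remains. *)
Lemma integration_error_error_rule n : (0 < n)%N -> (N %| n)%N ->
  integration_error N z (lc (error_rule n)) = (lattice_mean - grid_mean n)%:C.
Proof.
move=> n0 Nn.
have Hf : rk_space H (lc (error_rule n)) by apply: representer_space; exact:
  error_rule_cube.
have [cR cI] := cube_integral_multiples n0 Hf.
have ReL x : complex.Re (lc (error_rule n) x) = weighted_sumR (error_rule n) (kernelR
  x) by rewrite representerE.
have ImL x : complex.Im (lc (error_rule n) x) = 0 by rewrite representerE.
have iR : complex.Re (cube_integral (lc (error_rule n))) = 0.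
  rewrite -(cvg_lim (@Rhausdorff R) cR).
  under eq_fun do under eq_fun do rewrite ReL.
  under eq_fun => i do rewrite riemann_sum_error_rule ?dvdn_mulr ?muln_gt0 ?n0//.
  exact: lim_cst.
have iI : complex.Im (cube_integral (lc (error_rule n))) = 0.
  rewrite -(cvg_lim (@Rhausdorff R) cI).
  under eq_fun do under eq_fun do rewrite ImL.
  under eq_fun => i do rewrite /riemann_sum big1// mulr0.
  exact: lim_cst.
apply/eqP; rewrite eq_complex Re_integration_error Im_integration_error iR iI !add0r.
under eq_fun do rewrite ReL; under [X in _ && (weighted_sumR _ X == _)]eq_fun do
  rewrite ImL.
rewrite lattice_error_rule//= eqxx /= weighted_sumR_lattice big1 ?mulr0 ?oppr0//.
Qed.

(** Homogeneity of the integral is read off from the Riemann sums; the summand 0 gives the function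
    the shape required by [rk_lin]. *)
Lemma integration_error_scale (c : R) f : rk_space H f ->
  integration_error N z (fun x => c%:C * f x + 0) = c%:C * integration_error N z f.
Proof.
move=> Hf; have Hcf : rk_space H (fun x => c%:C * f x + 0).
  by apply: rk_lin => //; exact: rk_zero.
have [cR cI] := cube_integral_cvg Hf; have [cR' cI'] := cube_integral_cvg Hcf.
have eR x : complex.Re (c%:C * f x + 0) = c * complex.Re (f x) by rewrite addr0 Re_mulC.
have eI x : complex.Im (c%:C * f x + 0) = c * complex.Im (f x) by rewrite addr0 Im_mulC.
have rs F n : riemann_sum (fun x => c * F x) n = c * @riemann_sum R d F n.
  by rewrite /riemann_sum -mulr_sumr mulrCA.
have lf F : weighted_sumR lattice_rule (fun x => c * F x) = c * weighted_sumR
  lattice_rule F.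
  by rewrite !weighted_sumR_lattice -mulr_sumr mulrN mulrCA.
have iR : complex.Re (cube_integral (fun x => c%:C * f x + 0)) = c * complex.Re
  (cube_integral f).
  rewrite -(cvg_lim (@Rhausdorff R) cR').
  under eq_fun do under eq_fun do rewrite eR.
  under eq_fun do rewrite rs.
  by apply: cvg_lim => //; apply: cvgM => //; exact: cvg_cst.
have iI : complex.Im (cube_integral (fun x => c%:C * f x + 0)) = c * complex.Im
  (cube_integral f).
  rewrite -(cvg_lim (@Rhausdorff R) cI').
  under eq_fun do under eq_fun do rewrite eI.
  under eq_fun do rewrite rs.
  by apply: cvg_lim => //; apply: cvgM => //; exact: cvg_cst.
apply/eqP; rewrite eq_complex Re_mulC Im_mulC !Re_integration_error
  !Im_integration_error iR iI.
under [X in (_ + weighted_sumR _ X == _) && _]eq_fun do rewrite eR.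
under [X in _ && (_ + weighted_sumR _ X == _)]eq_fun do rewrite eI.
by rewrite !lf -!mulrDr !eqxx.
Qed.

Lemma rk_ip_scale (c : R) f : rk_space H f ->
  rk_ip H (fun x => c%:C * f x + 0) (fun x => c%:C * f x + 0) = (c ^+ 2)%:C * rk_ip H
    f f.
Proof.
move=> Hf; have H0 := rk_zero H; have Hcf := rk_lin c%:C Hf H0.
rewrite rk_ip_linear// (rk_ip_linearr _ Hf H0 Hf) (rk_ip_linearr _ Hf H0 H0).
rewrite !rk_ip0// (rk_ip_conj Hf H0) rk_ip0// rmorph0 mulr0 !addr0.
rewrite mulrA; congr (_ * _).
by apply/eqP; rewrite eq_complex /= oppr0 !mulr0 !mul0r subr0 addr0 expr2 !eqxx.
Qed.

(** The representer of [error_rule N] has squared norm [lattice_mean - grid_mean N], which is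
    nonnegative, and [grid_mean N] is at least 1. *)
Lemma lattice_mean_ge1 : 1 <= lattice_mean.
Proof.
have := @error_rule_sqnorm N N0 (dvdnn N).
have Hf : rk_space H (lc (error_rule N)) by apply: representer_space; exact:
  error_rule_cube.
have := rk_sq_ge0 Hf; rewrite /rk_sq rk_ip_representer//; last exact: error_rule_cube.
rewrite Re_weighted_sum; under eq_fun do rewrite representerE /=.
by move=> h e; have := grid_mean_ge1 N; lra.
Qed.

(** The upper bound is [error_bound]. For the lower bound, the normalised representers of
    [error_rule (N * i.+1)] have errors whose squares tend to [lattice_mean - 1]. *)
Lemma worst_case_errorE :
  worst_case_error N H z ^+ 2 = lattice_mean - 1.
Proof.
have W1 := lattice_mean_ge1.
rewrite /worst_case_error; set S := [set _ | _ in _].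
have ub : ubound S (Num.sqrt (lattice_mean - 1)).
  move=> _ [f [Hf f1] <-]; rewrite Re_normc ler_wsqrtr//.
  apply: le_trans (error_bound Hf) _.
  rewrite ler_piMl ?subr_ge0//.
  by move: f1; rewrite /rk_norm -[leRHS]sqrtr1 ler_sqrt.
have S0 : S 0.
  exists (fun=> 0).
    split; first exact: rk_zero.
    by rewrite /rk_norm rk_ip0 ?sqrtr0//; exact: rk_zero.
  rewrite Re_normc; apply/eqP; rewrite sqrtr_eq0.
  apply: le_trans (error_bound (rk_zero H)) _.
  by rewrite /rk_sq rk_ip0 ?mul0r//; exact: rk_zero.
have supS : has_sup S by split; [exists 0|exists (Num.sqrt (lattice_mean - 1))].
have sup0 : 0 <= sup S by apply: ub_le_sup => //; case: supS.
apply/eqP; rewrite eq_le; apply/andP; split.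
  rewrite -[leRHS]sqr_sqrtr ?subr_ge0// ler_sqr ?nnegrE ?sqrtr_ge0//.
  by apply: sup_le_ub => //; exists 0.
have c : lattice_mean - grid_mean (N * i.+1) @[i --> \oo] --> lattice_mean - 1.
  by apply: cvgB; [exact: cvg_cst|exact: grid_mean_multiples].
apply: cvgr_to_le c _; apply: nearW => i.
set n := (N * i.+1)%N; set v := _ - _.
have n0 : (0 < n)%N by rewrite muln_gt0 N0.
have [v0|v0] := leP v 0; first exact: le_trans v0 (sqr_ge0 _).
have Nn : (N %| n)%N by rewrite dvdn_mulr.
pose f := lc (error_rule n).
have Hf : rk_space H f by apply: representer_space; exact: error_rule_cube.
have sqf : rk_ip H f f = v%:C.
  rewrite rk_ip_self//; congr (_%:C); rewrite /rk_sq rk_ip_representer//; last exact: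
    error_rule_cube.
  rewrite Re_weighted_sum /v -(@error_rule_sqnorm n)//; apply: eq_bigr => p _.
  by rewrite /f representerE.
(* Both the squared norm and the error of [f] equal [v], so after division by [sqrt v] the norm is 1
   and the error is [sqrt v]. *)
pose c' : R := (Num.sqrt v)^-1.
have c'v : c' ^+ 2 * v = 1 by rewrite exprVn sqr_sqrtr ?(ltW v0)// mulVf// gt_eqF.
pose f' x := c'%:C * f x + 0.
have Hf' : rk_space H f' by apply: rk_lin => //; exact: rk_zero.
have Sv : S (Num.sqrt v).
  exists f'.
    split=> //; rewrite /rk_norm /f' rk_ip_scale// sqf -rmorphM /= c'v sqrtr1//.
  rewrite integration_error_scale// integration_error_error_rule// Re_normc -rmorphM
    /sqmod /=.
  rewrite expr0n addr0 sqrtr_sqr ger0_norm; last first.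
    by rewrite mulr_ge0 ?invr_ge0 ?sqrtr_ge0 ?(ltW v0).
  have e : v = Num.sqrt v * Num.sqrt v by rewrite -expr2 sqr_sqrtr// ltW.
  by rewrite -/v {1}e /c' mulKf// gt_eqF// sqrtr_gt0.
rewrite -[leLHS](sqr_sqrtr (ltW v0)) ler_sqr ?nnegrE ?sqrtr_ge0//.
exact: ub_le_sup (proj2 supS) _ Sv.
Qed.
End Lattice.
End Korobov.

(** * Sums over the dual lattice *)

Section PowerSubadditive.
Context {R : realType}.

(** A fraction [p] in [[0, 1]] satisfies [p <= p^l]; this is applied to [x / (x + y)] and
    [y / (x + y)], which add up to 1. *)
Lemma powRD_le (x y l : R) : 0 <= x -> 0 <= y -> 0 < l <= 1 ->
  (x + y) `^ l <= x `^ l + y `^ l.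
Proof.
move=> x0 y0 /andP[l0 l1].
have [xy0|] := eqVneq (x + y) 0.
  by rewrite xy0 powR0 ?gt_eqF// addr_ge0 ?powR_ge0.
move=> xyn0; have xy : 0 < x + y by rewrite lt_def xyn0 addr_ge0.
have h (t : R) : 0 <= t -> t <= x + y -> t / (x + y) * (x + y) `^ l <= t `^ l.
  move=> t0 txy; have [->|tn0] := eqVneq t 0; first by rewrite !mul0r powR_ge0.
  have tp : 0 < t / (x + y) by rewrite divr_gt0// lt_def tn0.
  have -> : t `^ l = (t / (x + y)) `^ l * (x + y) `^ l.
    by rewrite -powRM ?divfK// ltW.
  rewrite ler_wpM2r ?powR_ge0//.
  by apply: ger1_powR => //; rewrite tp ler_pdivrMr// mul1r.
have := h x x0; have := h y y0; rewrite lerDl lerDr => /(_ x0) hy /(_ y0) hx.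
by apply: le_trans (lerD hx hy); rewrite -!mulrDl divff// mul1r.
Qed.

Lemma powR_sum_le (I : Type) (r : seq I) (P : pred I) (f : I -> R) (l : R) :
  (forall i, P i -> 0 <= f i) -> 0 < l <= 1 ->
  (\sum_(i <- r | P i) f i) `^ l <= \sum_(i <- r | P i) f i `^ l.
Proof.
move=> f0 l01; have l0 : l != 0 by rewrite gt_eqF//; case/andP: l01.
suff [] : 0 <= \sum_(i <- r | P i) f i /\
  (\sum_(i <- r | P i) f i) `^ l <= \sum_(i <- r | P i) f i `^ l by [].
elim/big_rec2: _ => [|i y x Pi [x0 xy]]; first by rewrite powR0.
split; first by rewrite addr_ge0// f0.
by apply: le_trans (powRD_le (f0 i Pi) x0 l01) _; rewrite lerD2l.
Qed.

End PowerSubadditive.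

Lemma intr_Zp_eq0 (N : nat) (i : int) : (1 < N)%N ->
  ((i%:~R : 'Z_N) == 0) = (N%:Z %| i)%Z.
Proof.
move=> N1; have h (n : nat) : ((n%:R : 'Z_N) == 0) = (N %| n)%N.
  by rewrite -(inj_eq val_inj) /= val_Zp_nat.
case: i => n; first by rewrite -pmulrn h.
by rewrite NegzE mulrNz oppr_eq0 -pmulrn h dvdzE abszN.
Qed.

Lemma sum_fibers (R : pzSemiRingType) (T A : finType) (X : {set T}) (phi : T -> A) (F
  : A -> R) :
  \sum_(x in X) F (phi x) = \sum_a F a * #|[set x in X | phi x == a]|%:R.
Proof.
rewrite (partition_big phi xpredT)//=; apply: eq_bigr => a _.
rewrite mulr_natr -sumr_const.
by apply: congr_big => // x => [|/andP[_ /eqP ->]//]; rewrite inE.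
Qed.

Section Count.
Context {R : realType}.
Local Notation tau := (2 * pi : R).
Variables (N : nat) (zt : nat -> nat).
Hypothesis N1 : (1 < N)%N.

(* The sum of prod_j g_j / |h_j|^beta (factor 1 if h_j = 0) over the h in
   {-n, ..., n}^d such that h . zt = a (up to sign) modulo N. *)
Fixpoint dual_sum (n : nat) (g : nat -> R) (beta : R) (d : nat) (a : 'Z_N) : R :=
  if d is d'.+1 then
    dual_sum n g beta d' a + \sum_(0 <= h < n) g d * pterm beta h *
      (dual_sum n g beta d' (a + (h.+1 * zt d)%:R) +
       dual_sum n g beta d' (a - (h.+1 * zt d)%:R))
  else (a == 0)%:R.

Lemma dual_sum_ge0 n g beta d a : (forall j, (1 <= j)%N -> 0 <= g j) ->
  0 <= dual_sum n g beta d a.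
Proof.
move=> g0; elim: d a => [|d ih] a /=; first by case: eqP.
rewrite addr_ge0// sumr_ge0// => h _.
by rewrite mulr_ge0 ?addr_ge0 ?mulr_ge0 ?pterm_ge0 ?g0.
Qed.

Lemma shift_sum_powR n (c beta l : R) (G G' : 'Z_N -> R) v (a : 'Z_N) :
  0 <= c -> (forall x, 0 <= G x) -> (forall x, G x `^ l <= G' x) -> 0 < l <= 1 ->
  (\sum_(0 <= h < n) c * pterm beta h * (G (a + (h.+1 * v)%:R) + G (a - (h.+1 *
    v)%:R))) `^ l
  <= \sum_(0 <= h < n) c `^ l * pterm (beta * l) h *
       (G' (a + (h.+1 * v)%:R) + G' (a - (h.+1 * v)%:R)).
Proof.
move=> c0 G0 GG' l01; apply: le_trans (powR_sum_le _ _ l01) _.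
  by move=> h _; rewrite !mulr_ge0 ?addr_ge0 ?pterm_ge0.
apply: ler_sum => h _; rewrite !powRM ?mulr_ge0 ?addr_ge0 ?G0 ?pterm_ge0//.
have -> : pterm beta h `^ l = pterm (beta * l) h by rewrite /pterm -powRrM mulNr.
rewrite ler_wpM2l ?mulr_ge0 ?powR_ge0 ?pterm_ge0//.
by apply: le_trans (powRD_le _ _ l01) _; rewrite ?G0// lerD.
Qed.

Lemma dual_sum_powR n g beta d a (l : R) : (forall j, (1 <= j)%N -> 0 <= g j) ->
  0 < l <= 1 ->
  dual_sum n g beta d a `^ l <= dual_sum n (fun j => g j `^ l) (beta * l) d a.
Proof.
move=> g0 l01; have l0 : l != 0 by rewrite gt_eqF//; case/andP: l01.
elim: d a => [|d ih] a /=; first by case: eqP => _; rewrite ?powR1 ?powR0.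
have G0 x := dual_sum_ge0 n beta d x g0.
apply: le_trans (powRD_le _ _ l01) _ => //.
  by apply: sumr_ge0 => h _; rewrite !mulr_ge0 ?addr_ge0 ?pterm_ge0 ?g0.
by apply: lerD => //; apply: shift_sum_powR; rewrite ?g0.
Qed.

(** Translations permute the residues, so each signed frequency of the new component multiplies the
    total by its own weight. *)
Lemma dual_sum_total n g beta d : (forall j, (1 <= j)%N -> 0 <= g j) -> 1 < beta ->
  \sum_a dual_sum n g beta d a <= \prod_(j < d) (1 + 2 * g j.+1 * zeta beta).
Proof.
move=> g0 b1; elim: d => [|d ih].
  rewrite big_ord0 (bigD1 0)//= big1 ?addr0// => a /negbTE ->//.
rewrite [leRHS]big_ord_recr/= big_split/= exchange_big/=.
have S0 : 0 <= \sum_a dual_sum n g beta d a.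
  by apply: sumr_ge0 => a _; exact: dual_sum_ge0.
rewrite (eq_bigr (fun h => 2 * g d.+1 * pterm beta h * \sum_a dual_sum n g beta d
  a)); last first.
  move=> h _; rewrite -mulr_sumr big_split/=.
  have -> : \sum_a dual_sum n g beta d (a + (h.+1 * zt d.+1)%:R) = \sum_a dual_sum n
    g beta d a.
    by rewrite [RHS](reindex_inj (addIr (h.+1 * zt d.+1)%:R)).
  have -> : \sum_a dual_sum n g beta d (a - (h.+1 * zt d.+1)%:R) = \sum_a dual_sum n
    g beta d a.
    by rewrite [RHS](reindex_inj (addIr (- (h.+1 * zt d.+1)%:R))).
  by ring.
rewrite -mulr_suml -mulr_sumr -{1}[\sum_a _]mul1r -mulrDl mulrC.
have z0 : 0 <= zeta beta := zeta_ge0 b1.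
have := pseries_le_zeta n b1; rewrite /series /= => hz.
apply: ler_pM => //; first by rewrite addr_ge0// !mulr_ge0 ?g0 ?sumr_ge0// => i _;
  exact: pterm_ge0.
by rewrite lerD2l ler_wpM2l ?mulr_ge0 ?g0.
Qed.

(** A discrete cosine coefficient, along the lattice, of the truncated kernel; at [i = 0] it is the
    truncated [lattice_mean]. *)
Definition mean_kernel1n (alpha : R) (gamma : nat -> R) n d (i : int) : R :=
  N%:R^-1 * \sum_(k < N) (cos (tau * (i%:~R * k%:R / N%:R)) *
    \prod_(j < d) kernel1n alpha (gamma j.+1) n ((k * zt j.+1)%N%:R / N%:R)).

(* Character sums in real form: 2 cos A cos B = cos (A + B) + cos (A - B). *)
Lemma mean_kernel1nE (alpha : R) (gamma : nat -> R) n d (i : int) :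
  mean_kernel1n alpha gamma n d i = dual_sum n gamma alpha d i%:~R.
Proof.
have N0 : (0 < N)%N := ltnW N1.
have NR : N%:R != 0 :> R by rewrite pnatr_eq0 -lt0n.
elim: d i => [|d ih] i.
  rewrite /mean_kernel1n /= intr_Zp_eq0//; under eq_bigr do rewrite big_ord0 mulr1.
  by have [-> _] := @sum_expi R _ i N0; rewrite natrM mulKf.
have -> : dual_sum n gamma alpha d.+1 i%:~R =
    mean_kernel1n alpha gamma n d i + \sum_(0 <= h < n) gamma d.+1 * pterm alpha h *
     (mean_kernel1n alpha gamma n d (i + (h.+1 * zt d.+1)%N%:Z) +
      mean_kernel1n alpha gamma n d (i - (h.+1 * zt d.+1)%N%:Z)).
  rewrite /= ih; congr (_ + _); apply: eq_bigr => h _.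
  by rewrite !ih intrB intrD -!pmulrn.
rewrite /mean_kernel1n; set P := fun k : 'I_N =>
  \prod_(j < d) kernel1n alpha (gamma j.+1) n ((k * zt j.+1)%N%:R / N%:R).
set y := zt d.+1.
transitivity (N%:R^-1 * (\sum_(k < N) cos (tau * (i%:~R * k%:R / N%:R)) * P k +
   \sum_(0 <= h < n) gamma d.+1 * pterm alpha h * \sum_(k < N)
    (cos (tau * ((i + (h.+1 * y)%N%:Z)%:~R * k%:R / N%:R)) * P k +
     cos (tau * ((i - (h.+1 * y)%N%:Z)%:~R * k%:R / N%:R)) * P k))); last first.
  rewrite mulrDr [X in _ + X = _]mulr_sumr; congr (_ + _); apply: eq_bigr => h _.
  by rewrite big_split/= mulrCA mulrDr.
congr (_ * _); under [X in _ = _ + X]eq_bigr do rewrite mulr_sumr.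
rewrite exchange_big/= -big_split/=; apply: eq_bigr => k _.
rewrite big_ord_recr/= -/(P k) /kernel1n mulrA mulrDr mulr1 -/y; congr (_ + _).
rewrite mulrA mulr_sumr; apply: eq_bigr => h _.
rewrite -mulrDl.
set A := tau * (i%:~R * k%:R / N%:R); set B := tau * (h.+1%:R * ((k * y)%:R / N%:R)).
have -> : tau * ((i + (h.+1 * y)%N%:Z)%:~R * k%:R / N%:R) = A + B.
  by rewrite /A /B intrD -pmulrn !natrM; ring.
have -> : tau * ((i - (h.+1 * y)%N%:Z)%:~R * k%:R / N%:R) = A - B.
  by rewrite /A /B intrB -pmulrn !natrM; ring.
by rewrite cosD cosB; ring.
Qed.

(** Group the pairs [(h, x)] by the residue of [(h + 1) y(x)]: every value of [F] then occurs with
    weight at most [zb]. *)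
Lemma weighted_count (T : finType) (X : {set T}) (y : T -> nat) n (beta : R) (zb : R)
    (F : 'Z_N -> R) :
  (forall a, 0 <= F a) ->
  (forall a : 'Z_N, \sum_(0 <= h < n) pterm beta h *
     #|[set x in X | (h.+1 * y x)%:R == a]|%:R <= zb) ->
  \sum_(x in X) \sum_(0 <= h < n) pterm beta h * F (h.+1 * y x)%:R <= zb * \sum_a F a.
Proof.
move=> F0 hz; rewrite mulr_sumr.
have -> : \sum_(x in X) \sum_(0 <= h < n) pterm beta h * F (h.+1 * y x)%:R =
    \sum_a F a * \sum_(0 <= h < n) pterm beta h * #|[set x in X | (h.+1 * y x)%:R ==
      a]|%:R.
  under [RHS]eq_bigr do rewrite mulr_sumr.
  rewrite exchange_big [RHS]exchange_big/=; apply: eq_bigr => h _.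
  rewrite -mulr_sumr (sum_fibers _ (fun x => (h.+1 * y x)%:R)) mulr_sumr.
  by apply: eq_bigr => a _; rewrite mulrCA.
apply: ler_sum => a _; rewrite mulrC; exact: ler_wpM2r.
Qed.

End Count.

(** * Counting solutions of [h b^w x = a] in the reduced search space *)

Section SearchSpace.
Variables (b m w : nat).
Hypotheses (pb : prime b) (wm : (w < m)%N).

Let N1 : (1 < b ^ m)%N.
Proof. by rewrite -{1}(expn0 b) ltn_exp2l ?prime_gt1// (leq_ltn_trans _ wm). Qed.

Let b0 : (0 < b ^ w)%N. Proof. by rewrite expn_gt0 prime_gt0. Qed.

Let NE : (b ^ m = b ^ w * b ^ (m - w))%N. Proof. by rewrite -expnD subnKC// ltnW. Qed.

Local Notation sols h a :=
  [set x in reduced_search_space b m w | (h * (b ^ w * x))%:R == a :> 'Z_(b ^ m)]%SET.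

Lemma in_search_space (x : 'I_(b ^ m)) : x \in reduced_search_space b m w ->
  (x < b ^ (m - w))%N /\ coprime x (b ^ (m - w)).
Proof.
rewrite /reduced_search_space wm inE => /andP[/andP[x1 xm] cx]; split.
  by apply: leq_ltn_trans xm _; rewrite subn1 prednK// expn_gt0 prime_gt0.
by apply: coprime_dvdr cx; rewrite NE dvdn_mull.
Qed.

(* All h solving h b^w x = a share the same gcd with b^(m-w). *)
Lemma sols_gcd h (a : 'Z_(b ^ m)) (x : 'I_(b ^ m)) : x \in sols h a ->
  gcdn h (b ^ (m - w)) = (gcdn a (b ^ m) %/ b ^ w)%N.
Proof.
rewrite inE => /andP[/in_search_space[_ cx] /eqP <-].
rewrite val_Zp_nat// gcdn_modl {2}NE mulnCA -muln_gcdr mulKn//.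
by rewrite gcdnC [in RHS]gcdnC Gauss_gcdl// coprime_sym.
Qed.

(** After cancelling [b^w], two solutions agree modulo [M = N' / g]. The search space lies below
    [N' = M g], hence in [g] blocks of length [M], each holding at most one solution. *)
Lemma sols_card h (a : 'Z_(b ^ m)) : (0 < h)%N ->
  (#|sols h a| <= gcdn h (b ^ (m - w)))%N.
Proof.
move=> h0; set N' := (b ^ (m - w))%N; set g := gcdn h N'.
have N'0 : (0 < N')%N by rewrite expn_gt0 prime_gt0.
have g0 : (0 < g)%N by rewrite gcdn_gt0 h0.
pose M := (N' %/ g)%N.
have NM : N' = (M * g)%N by rewrite divnK// dvdn_gcdr.
have M0 : (0 < M)%N by move: N'0; rewrite NM muln_gt0 => /andP[].
have same (x y : 'I_(b ^ m)) : (y <= x)%N -> x \in sols h a -> y \in sols h a ->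
    (x %/ M = y %/ M)%N -> x = y.
  move=> yx; rewrite !inE => /andP[_ /eqP hx] /andP[_ /eqP hy] xy.
  have : (h * (b ^ w * x) == h * (b ^ w * y) %[mod b ^ m])%N.
    by rewrite -!val_Zp_nat// hx hy.
  rewrite eqn_mod_dvd; last by rewrite !leq_mul.
  rewrite -!mulnBr mulnCA {1}NE dvdn_pmul2l// -/N'.
  have -> : (h = (h %/ g) * g)%N by rewrite divnK// dvdn_gcdl.
  rewrite {1}NM mulnAC dvdn_pmul2r// Gauss_dvdr; last first.
    rewrite coprime_sym /coprime -(eqn_pmul2r g0) mul1n muln_gcdl -NM.
    by rewrite divnK ?dvdn_gcdl.
  rewrite -eqn_mod_dvd// => /eqP xym; apply: val_inj => /=.
  by rewrite (divn_eq x M) (divn_eq y M) xy xym.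
have lt_g (x : 'I_(b ^ m)) : x \in sols h a -> (x %/ M < g)%N.
  by rewrite inE => /andP[/in_search_space[xN _] _]; rewrite ltn_divLR// mulnC -NM.
case: g g0 @M NM M0 same lt_g => // g _ M NM M0 same lt_g.
pose f (x : 'I_(b ^ m)) : 'I_g.+1 := inord (x %/ M).
rewrite -[X in (_ <= X)%N]card_ord -(card_in_imset (f := f)) ?max_card//.
move=> x y xs ys /(congr1 val); rewrite /= !inordK ?lt_g// => xy.
have [yx|/ltnW xy'] := leqP y x; first exact: same.
by apply/esym; apply: same.
Qed.

(* With g the common gcd, only multiples h of g contribute, each at most g
   times, and g * g^-beta <= 1. *)
Lemma search_space_count (R : realType) (n : nat) (beta : R) (a : 'Z_(b ^ m)) :
  1 < beta -> \sum_(0 <= h < n) pterm beta h * #|sols h.+1 a|%:R <= zeta beta.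
Proof.
move=> b1; set g := (gcdn a (b ^ m) %/ b ^ w)%N.
have z0 : 0 <= zeta beta := zeta_ge0 b1.
have empty h : gcdn h.+1 (b ^ (m - w)) != g -> #|sols h.+1 a| = 0%N.
  move=> hg; apply/eqP; rewrite cards_eq0; apply/eqP/setP => x; rewrite finset.in_set0.
  by apply/negP => /sols_gcd e; rewrite e eqxx in hg.
(* The value 0 arises when [gcd(a, b^m) < b^w]; then there are no solutions, since a gcd with
   [h + 1] is positive. *)
case eg : g => [|g'].
  rewrite big1// => h _; rewrite empty ?mulr0// eg.
  by rewrite -lt0n gcdn_gt0.
apply: (@le_trans _ _ (\sum_(0 <= h < n | (g'.+1 %| h.+1)%N) pterm beta h * g'.+1%:R)).
  rewrite [leRHS]big_mkcond; apply: ler_sum => h _.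
  have [e|ne] := eqVneq (gcdn h.+1 (b ^ (m - w))) g; last first.
    by rewrite empty// mulr0; case: ifP => // _; rewrite mulr_ge0 ?pterm_ge0.
  rewrite -eg -e dvdn_gcdl ler_wpM2l ?pterm_ge0// ler_nat.
  exact: sols_card.
rewrite -mulr_suml; apply: (@le_trans _ _ (pterm beta g' * zeta beta * g'.+1%:R)).
  by rewrite ler_wpM2r// pseries_dvd_le.
rewrite mulrAC ler_piMl// -[X in _ * X]powRr1// /pterm -powRD; last first.
  by rewrite pnatr_eq0 implybT.
by rewrite -[leRHS](powRr0 g'.+1%:R) ler_powR ?ler1n//; lra.
Qed.

End SearchSpace.

(** * The increment caused by one new component, and its average over candidates *)

Section Step.
Context {R : realType}.
Variables (alpha : R) (gamma : nat -> R) (N : nat).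
Hypotheses (a1 : 1 < alpha) (g0 : forall j : nat, (1 <= j)%N -> 0 < gamma j).
Hypothesis N1 : (1 < N)%N.

Let g_ge0 j : (1 <= j)%N -> 0 <= gamma j. Proof. by move=> /g0/ltW. Qed.

Local Notation mean d z := (@lattice_mean R alpha gamma d N z).

Lemma dual_sum_mean zt d :
  dual_sum zt n gamma alpha d (0 : 'Z_N) @[n --> \oo] --> mean d (components zt d).
Proof.
have e n : dual_sum zt n gamma alpha d (0 : 'Z_N) = N%:R^-1 * \sum_(k < N)
    \prod_(j < d) kernel1n alpha (gamma j.+1) n ((k * zt j.+1)%N%:R / N%:R).
  rewrite -(mean_kernel1nE zt N1 alpha gamma n d 0) /mean_kernel1n; congr (_ * _).
  by apply: eq_bigr => k _; rewrite !mul0r mulr0 cos0 mul1r.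
under eq_fun do rewrite e.
apply: cvgM; first exact: cvg_cst.
apply: cvg_sumr => k _; apply: cvg_prodr => j _.
by rewrite tnth_mktuple; apply: kernel1n_cvg; rewrite // ltW// g0.
Qed.

Lemma dual_sum_ext (zt zt' : nat -> nat) n g (beta : R) d :
  (forall j, (j <= d)%N -> zt j = zt' j) ->
  dual_sum zt n g beta d =1 dual_sum zt' n g beta d :> ('Z_N -> R).
Proof.
elim: d => [//|d ih] e a /=; have {}ih := ih (fun j jd => e j (leqW jd)).
by rewrite ih e//; congr (_ + _); apply: eq_bigr => h _; rewrite !ih.
Qed.

(** The truncated theta(v): what appending the component [v] adds to [dual_sum] at residue 0. *)
Definition dual_inc zt n g (beta : R) d v : R :=
  \sum_(0 <= h < n) g d.+1 * pterm beta h *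
    (dual_sum zt n g beta d (0 + (h.+1 * v)%:R : 'Z_N) +
     dual_sum zt n g beta d (0 - (h.+1 * v)%:R : 'Z_N)).

Definition extend (zt : nat -> nat) d v j := if j == d.+1 then v else zt j.

Lemma components_extend zt d v :
  components (extend zt d v) d.+1 = [tuple of rcons (components zt d) v].
Proof.
apply: eq_from_tnth => j; rewrite tnth_mktuple (tnth_nth 0%N) /= nth_rcons size_tuple
  /extend eqSS.
rewrite card_ord; have [jd|dj|_] := ltngtP j d; last by rewrite ?ltnn ?eqxx.
  by have := tnth_nth 0%N (components zt d) (Ordinal jd); rewrite tnth_mktuple.
by have := leq_trans (ltn_ord j) dj; rewrite ltnn.
Qed.

Lemma components_rcons zt d :
  components zt d.+1 = [tuple of rcons (components zt d) (zt d.+1)].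
Proof.
rewrite -components_extend; apply: eq_from_tnth => j; rewrite !tnth_mktuple /extend.
by case: eqP => // ->.
Qed.

Lemma dual_inc_cvg zt d v :
  dual_inc zt n gamma alpha d v @[n --> \oo] -->
  mean d.+1 [tuple of rcons (components zt d) v] - mean d (components zt d).
Proof.
have e n : dual_inc zt n gamma alpha d v =
  dual_sum (extend zt d v) n gamma alpha d.+1 (0 : 'Z_N) -
  dual_sum zt n gamma alpha d (0 : 'Z_N).
  have ext : dual_sum (extend zt d v) n gamma alpha d =1 dual_sum zt n gamma alpha d
    :> ('Z_N -> R).
    by apply: dual_sum_ext => j jd; rewrite /extend ltn_eqF// ltnS.
  rewrite /= ext addrAC subrr add0r; apply: eq_bigr => h _.
  by rewrite !ext /extend eqxx.
under eq_fun do rewrite e.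
by apply: cvgB; [rewrite -components_extend|]; exact: dual_sum_mean.
Qed.

Lemma dual_inc_ge0 zt n d v : 0 <= dual_inc zt n gamma alpha d v.
Proof.
apply: sumr_ge0 => h _.
by rewrite !mulr_ge0 ?addr_ge0 ?pterm_ge0 ?dual_sum_ge0 ?g_ge0.
Qed.

Lemma mean_rcons_le zt d v :
  mean d (components zt d) <= mean d.+1 [tuple of rcons (components zt d) v].
Proof.
rewrite -subr_ge0 -(cvg_lim (@Rhausdorff R) (@dual_inc_cvg zt d v)).
by apply: limr_ge; [apply: cvgP; exact: dual_inc_cvg|apply: nearW => n; exact:
  dual_inc_ge0].
Qed.

Section Average.
Variables (T : finType) (X : {set T}) (y : T -> nat) (zt : nat -> nat) (d : nat) (l :
  R).
Hypotheses (l01 : 0 < l <= 1) (al1 : 1 < alpha * l).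
(** Left abstract so as to serve both the reduced search space and the forced component 0. *)
Hypothesis count : forall n (a : 'Z_N), \sum_(0 <= h < n) pterm (alpha * l) h *
  #|[set x in X | (h.+1 * y x)%:R == a]%SET|%:R <= zeta (alpha * l).

Let bound := 2 * gamma d.+1 `^ l * zeta (alpha * l) *
  \prod_(j < d) (1 + 2 * gamma j.+1 `^ l * zeta (alpha * l)).

(** The power [l] moves inside by subadditivity; each sign of the frequency is then handled by
    [weighted_count], whence the factor 2, and [dual_sum_total] bounds the sum over residues. *)
Lemma dual_inc_sum n : \sum_(x in X) dual_inc zt n gamma alpha d (y x) `^ l <= bound.
Proof.
pose G := dual_sum zt n (fun j => gamma j `^ l) (alpha * l) d : 'Z_N -> R.
have gl j : (1 <= j)%N -> 0 <= gamma j `^ l by rewrite powR_ge0.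
have G0 a : 0 <= G a by exact: dual_sum_ge0.
have z0 := zeta_ge0 al1.
apply: (@le_trans _ _ (\sum_(x in X) gamma d.+1 `^ l *
   (\sum_(0 <= h < n) pterm (alpha * l) h * G (h.+1 * y x)%:R +
    \sum_(0 <= h < n) pterm (alpha * l) h * G (- (h.+1 * y x)%:R)))).
  apply: ler_sum => x _.
  apply: le_trans (@shift_sum_powR _ _ n _ _ _ _ G _ _ _ _ _ l01) _; rewrite ?g_ge0//.
  - by move=> a; apply: dual_sum_ge0; exact: g_ge0.
  - by move=> a; apply: dual_sum_powR.
  rewrite -big_split mulr_sumr le_eqVlt; apply/orP; left; apply/eqP.
  by apply: eq_bigr => h _; rewrite /= !add0r -mulrDr mulrA.
rewrite -mulr_sumr big_split/=.
have h1 := weighted_count G0 (count n).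
have h2 := weighted_count (fun a => G0 (- a)) (count n).
have eN : \sum_a G (- a) = \sum_a G a by rewrite [RHS](reindex_inj oppr_inj).
rewrite eN in h2.
have h3 := @dual_sum_total R N zt n _ _ d gl al1.
have -> : bound = gamma d.+1 `^ l * (2 * (zeta (alpha * l) *
    \prod_(j < d) (1 + 2 * gamma j.+1 `^ l * zeta (alpha * l)))) by rewrite /bound;
      ring.
rewrite ler_wpM2l ?powR_ge0//.
apply: le_trans (lerD h1 h2) _; rewrite -mulr2n -[leLHS]mulr_natl ler_wpM2l//.
by rewrite ler_wpM2l.
Qed.

(** A lower bound for all increments over [X'] is at most their average, and the sum over [X'] is at
    most that over [X]. As [dual_inc_sum] concerns truncations, the claim is first shown for every
    [c < theta]. *)
Lemma min_inc_bound (X' : {set T}) (theta : R) : X' \subset X -> (0 < #|X'|)%N ->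
  (forall x, x \in X' -> theta <=
    mean d.+1 [tuple of rcons (components zt d) (y x)] - mean d (components zt d)) ->
  0 <= theta -> theta `^ l <= #|X'|%:R^-1 * bound.
Proof.
move=> X'X X'0 hth th0; case/andP: (l01) => l0 l1.
have M0 : 0 < #|X'|%:R :> R by rewrite ltr0n.
have z0 := zeta_ge0 al1.
have b0 : 0 <= bound.
  rewrite !mulr_ge0 ?powR_ge0// prodr_ge0// => j _.
  by rewrite addr_ge0// !mulr_ge0 ?powR_ge0.
have below c : 0 <= c -> c < theta -> c `^ l <= #|X'|%:R^-1 * bound.
  move=> c0 cth; rewrite ler_pdivlMl//.
  (* Finiteness of the candidate set yields one truncation index valid for all of them. *)
  have near_n : \forall n \near \oo, forall x : T, x \in X' ->
      c <= dual_inc zt n gamma alpha d (y x).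
    apply: filter_forall => x; case: (boolP (x \in X')) => xX'; last exact: nearW.
    have /cvgr_ge/(_ _ (lt_le_trans cth (hth x xX'))) := @dual_inc_cvg zt d (y x).
    by apply: filterS.
  have [n hn] := filter_ex near_n.
  apply: le_trans (dual_inc_sum n).
  rewrite mulr_natl -sumr_const.
  apply: (@le_trans _ _ (\sum_(x in X') dual_inc zt n gamma alpha d (y x) `^ l)).
    apply: ler_sum => x xX'; apply: ge0_ler_powR; rewrite ?nnegrE ?(ltW l0)// ?hn//.
    exact: dual_inc_ge0.
  rewrite big_mkcond [leRHS]big_mkcond; apply: ler_sum => x _ /=.
  case: ifP => [/(fintype.subsetP X'X) -> //|_]; case: ifP => _ //; exact: powR_ge0.
rewrite leNgt; apply/negP => lt.
(* [t] is the threshold with [t^l] equal to the bound; if it were below [theta], their midpoint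
   would contradict [below]. *)
pose t := (#|X'|%:R^-1 * bound) `^ l^-1.
have bM0 : 0 <= #|X'|%:R^-1 * bound by rewrite mulr_ge0// invr_ge0 ltW.
have tl : t `^ l = #|X'|%:R^-1 * bound.
  by rewrite /t -powRrM mulVf ?gt_eqF// powRr1.
have t0 : 0 <= t by exact: powR_ge0.
have tth : t < theta.
  rewrite ltNge; apply/negP => h; move: lt; rewrite -tl ltNge.
  by rewrite ge0_ler_powR ?nnegrE ?(ltW l0).
have := below ((t + theta) / 2); rewrite -tl.
have -> : 0 <= (t + theta) / 2 by lra.
have -> : (t + theta) / 2 < theta by lra.
move=> /(_ isT isT); rewrite leNgt gt0_ltr_powR ?nnegrE//; lra.
Qed.

End Average.
End Step.

(** * The algorithm *)

Lemma sum_subsets_prod (R : comPzRingType) (I : finType) (f : I -> R) :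
  \sum_(u : {set I}) \prod_(j in u) f j = \prod_j (1 + f j).
Proof.
under [RHS]eq_bigr do rewrite addrC.
rewrite bigA_distr /=; apply: eq_bigr => u _.
by rewrite big_mkcond.
Qed.

Lemma powR_prod (R : realType) (I : Type) (r : seq I) (P : pred I) (f : I -> R) (l :
  R) :
  (forall i, P i -> 0 <= f i) ->
  (\prod_(i <- r | P i) f i) `^ l = \prod_(i <- r | P i) f i `^ l.
Proof.
move=> f0; suff [] : 0 <= \prod_(i <- r | P i) f i /\
  (\prod_(i <- r | P i) f i) `^ l = \prod_(i <- r | P i) f i `^ l by [].
elim/big_rec2: _ => [|i y x Pi [x0 xy]]; first by rewrite powR1.
by rewrite mulr_ge0 ?f0// powRM ?f0// xy.
Qed.

Section SearchSpaces.
Variables (b m : nat).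
Hypotheses (pb : prime b) (m0 : (0 < m)%N).

Lemma prime_power_gt1 : (1 < b ^ m)%N.
Proof. by rewrite -{1}(expn0 b) ltn_exp2l ?prime_gt1. Qed.

Lemma card_coprime_residues : #|coprime_residues (b ^ m)| = totient (b ^ m).
Proof.
rewrite totient_count_coprime big_mkord -sum1_card big_mkcond /=.
apply: eq_bigr => x _; rewrite inE [coprime (b ^ m) x]coprime_sym.
have -> : (x <= b ^ m - 1)%N by rewrite subn1 -ltnS prednK ?ltn_ord// ltnW//
  prime_power_gt1.
case: (posnP x) => [->|//] /=.
by rewrite /coprime gcd0n gtn_eqF// prime_power_gt1.
Qed.

Lemma search_space_sub w : reduced_search_space b m w \subset coprime_residues (b ^ m).
Proof.
apply/fintype.subsetP => x; have h : (x <= b ^ m - 1)%N.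
  by rewrite subn1 -ltnS prednK ?ltn_ord// ltnW// prime_power_gt1.
rewrite /reduced_search_space; case: ifP => _; rewrite !inE h andbT.
  by case/andP => /andP[-> _] ->.
by move=> /eqP ->; rewrite coprime1n.
Qed.

Lemma one_in_search_space w : Ordinal prime_power_gt1 \in reduced_search_space b m w.
Proof.
rewrite /reduced_search_space; case: ltnP => wm; rewrite inE//= coprime1n andbT.
by rewrite subn_gt0 -{1}(expn0 b) ltn_exp2l ?prime_gt1// subn_gt0.
Qed.

(** The auxiliary exclusion set is the complement, among the units, of the candidates actually
    allowed; so the denominators in the theorem count those candidates. *)
Lemma card_aux_exclusion w (E : nat -> {set 'I_(b ^ m)}) j :
  E j \subset reduced_search_space b m (w j) ->
  (#|aux_exclusion w E j| + #|reduced_search_space b m (w j) :\: E j| =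
   totient (b ^ m))%N.
Proof.
move=> EZ; rewrite -card_coprime_residues; set C := coprime_residues _.
set Z := reduced_search_space _ _ _ in EZ *.
have ZC : Z \subset C by exact: search_space_sub.
have -> : aux_exclusion w E j = C :\: (Z :\: E j).
  apply/setP => x; rewrite /aux_exclusion -/C -/Z !(finset.in_setU, finset.in_setD).
  have := fintype.subsetP EZ x; have := fintype.subsetP ZC x; rewrite -/Z -/C.
  by case: (x \in E j); case: (x \in Z); case: (x \in C) => // h1 h2;
    first [by move: (h1 isT)|by move: (h2 isT)].
rewrite -[RHS](cardsID (Z :\: E j)) addnC; congr (_ + _)%N.
apply: eq_card => x; rewrite !(finset.in_setI, finset.in_setD); case: (boolP (x \in
  Z)); rewrite ?andbF//.
by move=> /(fintype.subsetP ZC) ->.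
Qed.

End SearchSpaces.

(** * The error bound along a run, by induction on the dimension *)

Section Run.
Context {R : realType}.
Variables (s b m : nat) (w : nat -> nat) (alpha : R) (gamma : nat -> R).
Variables (H : forall d : nat, korobov_space alpha gamma d).
Variables (E : nat -> {set 'I_(b ^ m)}) (z : nat -> 'I_(b ^ m)) (zt : nat -> nat).
Hypotheses (pb : prime b) (m0 : (0 < m)%N) (w1 : w 1%N = 0%N).
Hypotheses (a1 : 1 < alpha) (g0 : forall j : nat, (1 <= j)%N -> 0 < gamma j).
Hypothesis run : combined_cbc H w s E z zt.

Local Notation N := (b ^ m)%N.
Local Notation Z j := (reduced_search_space b m (w j)).
Local Notation mean d x := (@lattice_mean R alpha gamma d N x).
Local Notation allowed j := (#|Z j :\: E j|).

Let N1 : (1 < N)%N := prime_power_gt1 pb m0.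

Lemma run_proper j : (1 <= j <= s)%N -> E j \proper Z j.
Proof.
have set0_proper : finset.set0 \proper Z j.
  rewrite proper0; apply/set0Pn; exists (Ordinal N1); exact: one_in_search_space.
case: j set0_proper => [//|[|j]] set0_proper /andP[_ js].
  by case: run => _ _ -> _.
case: run => _ _ _ /(_ j.+1); rewrite js => /(_ isT).
by case: ifP => _ [] // ->.
Qed.

Lemma allowed_gt0 j : (1 <= j <= s)%N -> (0 < allowed j)%N.
Proof.
move=> /run_proper/properP[_ [x xZ xE]]; apply/card_gt0P; exists x.
by rewrite !inE xE.
Qed.

Lemma allowed_le j : (allowed j <= totient N)%N.
Proof.
rewrite -card_coprime_residues//; apply: subset_leq_card.
by apply: fintype.subset_trans (search_space_sub pb m0 (w j)); exact: subsetDl.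
Qed.

Lemma natr_allowed j : (1 <= j <= s)%N ->
  (totient N)%:R - #|aux_exclusion w E j|%:R = (allowed j)%:R :> R.
Proof.
move=> js; rewrite -(card_aux_exclusion pb m0 (proper_sub (run_proper js))).
by rewrite natrD addrAC subrr add0r.
Qed.

(* At the first step the minimality condition is void, but multiplication by a
   unit permutes the lattice, so all units do equally well. *)
Lemma mean_first v : coprime v N ->
  mean 1%N [tuple of rcons (components zt 0) v] =
  mean 1%N [tuple of rcons (components zt 0) 1%N].
Proof.
move=> cv; apply: (addIr (- mean 0%N (components zt 0))).
have c1 := @dual_inc_cvg R alpha gamma N a1 N1 zt 0 v.
rewrite -(cvg_lim (@Rhausdorff R) c1).
apply: cvg_lim => //.
have e n : dual_inc N zt n gamma alpha 0 v = dual_inc N zt n gamma alpha 0 1.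
  have h u (k : nat) : coprime u N -> ((k * u)%:R == 0 :> 'Z_N) = (N %| k)%N.
    move=> cu; rewrite pmulrn intr_Zp_eq0// dvdzE /=.
    by rewrite Gauss_dvdl// coprime_sym.
  apply: eq_bigr => k _; rewrite /= !add0r !oppr_eq0.
  by rewrite !h// coprime1n.
under eq_fun do rewrite e.
exact: dual_inc_cvg.
Qed.

(** Every case reduces to [min_inc_bound]: the first component by [mean_first], a chosen one by
    minimality, and a forced 0 through a one-point candidate set. *)
Lemma run_increment d (l : R) : (d < s)%N -> 0 < l <= 1 -> 1 < alpha * l ->
  (mean d.+1 (components zt d.+1) - mean d (components zt d)) `^ l <=
  (allowed d.+1)%:R^-1 * (2 * gamma d.+1 `^ l * zeta (alpha * l) *
  \prod_(j < d) (1 + 2 * gamma j.+1 `^ l * zeta (alpha * l))).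
Proof.
move=> ds l01 al1.
have ds' : (1 <= d.+1 <= s)%N by [].
rewrite components_rcons.
have inc0 : 0 <= mean d.+1 [tuple of rcons (components zt d) (zt d.+1)] -
    mean d (components zt d) by rewrite subr_ge0 mean_rcons_le.
have [wm|mw] := ltnP (w d.+1) m.
  have cnt n a := search_space_count pb wm n a al1.
  apply: (min_inc_bound (zt := zt) a1 g0 N1 l01 al1 cnt) => //; first exact: subsetDl.
    exact: allowed_gt0.
  move=> x xZ; rewrite lerD2r; case: d => [|d] in ds ds' inc0 wm cnt x xZ *.
    have [_ -> _ _] := run; rewrite w1 expn0 mul1n [leRHS]mean_first//.
    move: xZ; rewrite inE => /andP[_ /(fintype.subsetP (search_space_sub pb m0 _))].
    by rewrite inE => /andP[_].
  case: run => _ _ _ /(_ d.+1); rewrite ds => /(_ isT); rewrite wm => -[_ _ min ->].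
  have := min x xZ.
  by rewrite !worst_case_errorE ?(ltnW N1)// lerD2r.
have card1 : allowed d.+1 = 1%N.
  have := @run_proper d.+1 ds'.
  have Z1 : Z d.+1 = finset.set1 (Ordinal N1).
    by apply/setP => x; rewrite /reduced_search_space ltnNge mw !inE.
  by rewrite Z1 properEcard => /andP[]; rewrite cards1 ltnS leqn0 cards_eq0 => _ /eqP
    ->;
    rewrite finset.setD0 cards1.
have ztd : zt d.+1 = 0%N.
  case: d ds mw {ds' inc0 card1} => [|d] ds mw; first by move: mw; rewrite w1 leqNgt m0.
  case: run => _ _ _ /(_ d.+1); rewrite ds => /(_ isT).
  by rewrite ltnNge mw => -[].
(* For the component 0 the only candidate meets each residue at most once per frequency, so the
   weighted count is at most a partial sum of zeta. *)
have cnt n (a : 'Z_N) : \sum_(0 <= h < n) pterm (alpha * l) h *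
    #|[set x in [set: unit] | (h.+1 * 0)%:R == a]%SET|%:R <= zeta (alpha * l).
  apply: le_trans (pseries_le_zeta n al1); apply: ler_sum => h _.
  rewrite ler_piMr ?pterm_ge0// lern1; apply: leq_trans (max_card _) _.
  by rewrite card_unit.
have := @min_inc_bound _ _ _ _ a1 g0 N1 _ _ (fun=> 0%N) zt d l l01 al1 cnt [set:
  unit]%SET.
rewrite cardsT card_unit card1; apply=> //.
by move=> _ _; rewrite ztd.
Qed.

(** The new increment is added by subadditivity of the power [l], and its bound fits the last factor
    of the product. In dimension 0 the mean is 1. *)
Lemma run_bound d (l : R) : (d <= s)%N -> 0 < l <= 1 -> 1 < alpha * l ->
  (mean d (components zt d) - 1) `^ l <= (totient N)%:R^-1 *
  \prod_(j < d) (1 + gamma j.+1 `^ l * (2 * zeta (alpha * l)) *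
     ((totient N)%:R / (allowed j.+1)%:R)).
Proof.
move=> + l01 al1; have l0 : l != 0 by rewrite gt_eqF//; case/andP: l01.
have z0 := zeta_ge0 al1.
have phi0 : 0 < (totient N)%:R :> R by rewrite ltr0n totient_gt0 ltnW.
have NR : N%:R != 0 :> R by rewrite pnatr_eq0 -lt0n ltnW.
elim: d => [|d ih] ds.
  rewrite /lattice_mean big_ord0 mulr1; under eq_bigr do rewrite big_ord0.
  by rewrite sumr_const card_ord mulVf// subrr powR0// invr_ge0 ltW.
have {}ih := ih (ltnW ds).
rewrite -[X in X - 1](subrK (mean d (components zt d))) -addrA.
apply: le_trans (powRD_le _ _ l01) _.
- by rewrite components_rcons subr_ge0 mean_rcons_le.
- by rewrite subr_ge0; exact: (lattice_mean_ge1 (H d) a1 g0 _ (ltnW N1)).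
rewrite big_ord_recr /= mulrDr mulr1 mulrDr [leRHS]addrC lerD//.
apply: le_trans (run_increment ds l01 al1) _.
set P := \prod_(j < d) _; set Q := \prod_(j < d) _.
(* The increment bound lacks the ratios [phi(N) / allowed]; each is at least 1, so they may be
   inserted. *)
have PQ : P <= Q.
  apply: ler_prod => j _; rewrite addr_ge0 ?mulr_ge0 ?powR_ge0//= lerD2l.
  have -> : 2 * gamma j.+1 `^ l * zeta (alpha * l) =
    gamma j.+1 `^ l * (2 * zeta (alpha * l)) by ring.
  rewrite ler_peMr ?mulr_ge0 ?powR_ge0//.
  have js : (1 <= j.+1 <= s)%N by rewrite (leq_trans (ltn_ord j))// ltnW.
  by rewrite ler_pdivlMr ?ltr0n ?allowed_gt0// mul1r ler_nat allowed_le.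
have M0 : 0 < (allowed d.+1)%:R :> R by rewrite ltr0n allowed_gt0.
rewrite [leRHS](_ : _ =
  (allowed d.+1)%:R^-1 * (2 * gamma d.+1 `^ l * zeta (alpha * l) * Q)); last first.
  by field; rewrite !gt_eqF.
by rewrite ler_wpM2l ?invr_ge0 ?(ltW M0)// ler_wpM2l// !mulr_ge0 ?powR_ge0.
Qed.

End Run.

Theorem theorem3p1 (R : realType) (s b m : nat) (w : nat -> nat)
    (alpha : R) (gamma : nat -> R)
    (H : forall d : nat, korobov_space alpha gamma d)
    (E : nat -> {set 'I_(b ^ m)}) (z : nat -> 'I_(b ^ m)) (zt : nat -> nat) :
  (1 <= s)%N -> prime b -> (1 <= m)%N ->
  w 1%N = 0%N ->
  (forall j : nat, (1 <= j)%N -> (w j <= w j.+1)%N) ->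
  1 < alpha ->
  (forall j : nat, (1 <= j)%N -> 0 < gamma j) ->
  combined_cbc H w s E z zt ->
  forall (d : nat) (lambda : R),
    (1 <= d <= s)%N -> alpha^-1 < lambda -> lambda <= 1 ->
    worst_case_error (b ^ m) (H d) (components zt d) ^+ 2 <=
    ((totient (b ^ m))%:R^-1 *
     \sum_(u : {set 'I_d})
        ((\prod_(j in u) gamma j.+1) `^ lambda *
         (2 * zeta (alpha * lambda)) ^+ #|u| *
         \prod_(j in u) ((totient (b ^ m))%:R /
           ((totient (b ^ m))%:R - #|aux_exclusion w E j.+1|%:R)))
    ) `^ (lambda^-1).
Proof.
move=> _ pb m0 w1 _ a1 g0 run d l /andP[d1 ds] al l1.
have a0 : 0 < alpha by lra.
have l0 : 0 < l by apply: lt_trans al; rewrite invr_gt0.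
have al1 : 1 < alpha * l by rewrite -ltr_pdivrMl// mulr1.
have l01 : 0 < l <= 1 by rewrite l0.
have N0 : (0 < b ^ m)%N by rewrite expn_gt0 prime_gt0.
have bound := run_bound pb m0 w1 a1 g0 run ds l01 al1.
rewrite worst_case_errorE//.
have e0 : 0 <= lattice_mean alpha gamma (b ^ m) (components zt d) - 1.
  by rewrite subr_ge0 (lattice_mean_ge1 (H d)).
rewrite -[leLHS]powRr1// -[X in _ `^ X](mulfV (lt0r_neq0 l0)) powRrM.
(* The sum over subsets is the expanded product of [run_bound], with the denominators rewritten as
   numbers of allowed candidates. *)
have -> : \sum_(u : {set 'I_d})
        ((\prod_(j in u) gamma j.+1) `^ l * (2 * zeta (alpha * l)) ^+ #|u| *
         \prod_(j in u) ((totient (b ^ m))%:R /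
           ((totient (b ^ m))%:R - #|aux_exclusion w E j.+1|%:R))) =
  \prod_(j < d) (1 + gamma j.+1 `^ l * (2 * zeta (alpha * l)) *
     ((totient (b ^ m))%:R / #|reduced_search_space b m (w j.+1) :\: E j.+1|%:R)).
  rewrite -sum_subsets_prod; apply: eq_bigr => u _.
  rewrite powR_prod; last by move=> j _; rewrite ltW// g0.
  rewrite -prodr_const -!big_split/=; apply: eq_bigr => j _.
  rewrite (natr_allowed pb m0 run)//.
  by rewrite (leq_trans (ltn_ord j)).
apply: ge0_ler_powR; rewrite ?nnegrE ?invr_ge0 ?(ltW l0) ?powR_ge0//.
exact: le_trans (powR_ge0 _ _) bound.
Qed.
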